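(* Let $(A,\Delta)$ be a multiplier Hopf $^*$-algebra with positive integrals and let $(M,\Delta)$ be the locally compact quantum group (von Neumann algebraic) obtained by completing $A$ on the GNS Hilbert space $\mathcal H$ of a positive right integral $\psi$. The C$^*$-algebraic quantum group obtained from $(M,\Delta)$ using the general theory of locally compact quantum groups is the pair $(P,\Delta)$, where $P$ is the norm closure of $A$ acting on $\mathcal H$ and where $\Delta$ is the restriction to $P$ of the coproduct on $M$.
   Context: A multiplier Hopf $^*$-algebra $(A,\Delta)$ is a $^*$-algebra $A$ over $\mathbb C$ with non-degenerate product (possibly without unit), with multiplier algebra $M(A)$, and a coassociative $^*$-homomorphism $\Delta:A\to M(A\otimes A)$ (algebraic tensor product) such that $a\otimes a'\mapsto\Delta(a)(1\otimes a')$ and $a\otimes a'\mapsto(a\otimes1)\Delta(a')$ are bijections of $A\otimes A$ onto itself. A left (respectively right) integral is a non-zero linear functional $\varphi$ (respectively $\psi$) with $(\iota\otimes\varphi)\Delta(a)=\varphi(a)1$ (respectively $(\psi\otimes\iota)\Delta(a)=\psi(a)1$) in $M(A)$ for all $a\in A$. ''With positive integrals'' means that positive left and right integrals exist ($\omega$ is positive if $\omega(a^*a)\ge 0$ for all $a$). Integrals are faithful. $\mathcal H$ is the Hilbert space completion of $A$ for the scalar product $\langle a',a\rangle=\psi(a^*a')$, and $\Lambda:A\to\mathcal H$ the canonical injection. $A$ acts faithfully by bounded operators on $\mathcal H$ via $a\Lambda(x)=\Lambda(ax)$, and is identified with its image; $M$ is the weak closure of $A$. The unitary $V$ on $\mathcal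 H\otimes\mathcal H$ is given by $V(\Lambda(x)\otimes\Lambda(x'))=\sum_{(x)}\Lambda(x_{(1)})\otimes\Lambda(x_{(2)}x')$ for $x,x'\in A$, and the coproduct on $M$ is $\Delta(x)=V(x\otimes1)V^*$. With this coproduct, $(M,\Delta)$ is a locally compact quantum group in the sense of Kustermans and Vaes, and $V$ is its right regular representation. In the general theory, the C$^*$-algebraic quantum group associated with $(M,\Delta)$ has as underlying C$^*$-algebra the norm closure of $\{(\omega\otimes\iota)V\mid\omega \text{ a normal linear functional on } \mathcal B(\mathcal H)\}$, with as coproduct the restriction of the coproduct of $M$. *)

(* Defs.v *)
From HB Require Import structures.
From mathcomp Require Import all_boot all_order all_algebra generic_quotient.
From mathcomp Require Import complex.
From mathcomp Require Import all_classical all_reals all_analysis.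

Set Implicit Arguments.
Unset Strict Implicit.
Unset Printing Implicit Defensive.

Import Order.TTheory GRing.Theory Num.Theory.
Import numFieldNormedType.Exports.

Local Open Scope classical_set_scope.
Local Open Scope ring_scope.
Local Open Scope quotient_scope.

Definition bilin (R : comNzRingType) (U V W : lmodType R) (f : U -> V -> W) :=
  (forall v, linear (f^~ v)) /\ (forall u, linear (f u)).

Section Tensor.
Variables (R : comNzRingType) (U V : lmodType R).
Implicit Types W : lmodType R.

(* [s : seq (U * V)] stands for the formal sum of the [p.1 (x) p.2], [p <- s];
   two formal sums are identified when no bilinear map separates them. *)
Definition fsum W (f : U -> V -> W) (s : seq (U * V)) : W :=
  \sum_(p <- s) f p.1 p.2.

Definition teq (s t : seq (U * V)) : bool :=
  `[< forall W (f : U -> V -> W), bilin f -> fsum f s = fsum f t >].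

Lemma teq_refl : reflexive teq.
Proof. by move=> s; apply/asboolP. Qed.

Lemma teq_sym : symmetric teq.
Proof.
by move=> s t; apply/asboolP/asboolP => h W f bf; rewrite h.
Qed.

Lemma teq_trans : transitive teq.
Proof.
move=> t s u /asboolP st /asboolP tu; apply/asboolP => W f bf.
by rewrite st// tu.
Qed.

Canonical teq_equiv := EquivRel teq teq_refl teq_sym teq_trans.

Definition tensor := {eq_quot teq}.
HB.instance Definition _ := Choice.on tensor.
HB.instance Definition _ := EqQuotient.on tensor.

Definition tens (u : U) (v : V) : tensor := \pi_tensor [:: (u, v)].

(* the linear map induced by a bilinear map [f]; meaningless otherwise *)
Definition tlift W (f : U -> V -> W) (x : tensor) : W := fsum f (repr x).

Lemma tlift_pi W (f : U -> V -> W) s : bilin f ->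
  tlift f (\pi_tensor s) = fsum f s.
Proof.
move=> bf; rewrite /tlift.
have /eqmodP/asboolP : repr (\pi_tensor s) = s %[mod tensor].
  by rewrite reprK.
exact.
Qed.

Lemma tensorP (x y : tensor) :
  (forall W (f : U -> V -> W), bilin f -> tlift f x = tlift f y) -> x = y.
Proof.
move=> h; rewrite -[x]reprK -[y]reprK; apply/eqmodP/asboolP => W f bf.
exact: h.
Qed.

Definition tzero : tensor := \pi_tensor [::].
Definition tadd (x y : tensor) : tensor := \pi_tensor (repr x ++ repr y).
Definition tscale (c : R) (x : tensor) : tensor :=
  \pi_tensor [seq (c *: p.1, p.2) | p <- repr x].

Section lift.
Variables (W : lmodType R) (f : U -> V -> W) (bf : bilin f).

Lemma tlift0_ : tlift f tzero = 0.
Proof. by rewrite tlift_pi// /fsum big_nil. Qed.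

Lemma tliftD_ x y : tlift f (tadd x y) = tlift f x + tlift f y.
Proof. by rewrite tlift_pi// /fsum big_cat. Qed.

Lemma tliftZ_ c x : tlift f (tscale c x) = c *: tlift f x.
Proof.
rewrite tlift_pi// /fsum big_map scaler_sumr; apply: eq_bigr => p _ /=.
exact: (scalable_linear (bf.1 p.2)).
Qed.

End lift.

Definition topp (x : tensor) := tscale (-1) x.

Local Ltac tens_axiom := apply: tensorP => ? ? ?;
  rewrite /topp ?(tliftD_, tliftZ_, tlift0_)//.

Lemma taddA : associative tadd. Proof. by move=> x y z; tens_axiom; rewrite addrA. Qed.
Lemma taddC : commutative tadd. Proof. by move=> x y; tens_axiom; rewrite addrC. Qed.
Lemma tadd0 : left_id tzero tadd. Proof. by move=> x; tens_axiom; rewrite add0r. Qed.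
Lemma taddN : left_inverse tzero topp tadd.
Proof. by move=> x; tens_axiom; rewrite scaleN1r addNr. Qed.

HB.instance Definition _ := GRing.isZmodule.Build tensor taddA taddC tadd0 taddN.

Lemma tscaleA a b x : tscale a (tscale b x) = tscale (a * b) x.
Proof. by tens_axiom; rewrite scalerA. Qed.
Lemma tscale1 : left_id 1 tscale.
Proof. by move=> x; tens_axiom; rewrite scale1r. Qed.
Lemma tscaleDr : right_distributive tscale +%R.
Proof. by move=> a x y; tens_axiom; rewrite scalerDr. Qed.
Lemma tscaleDl x : {morph tscale^~ x : a b / a + b}.
Proof. by move=> a b; tens_axiom; rewrite scalerDl. Qed.

HB.instance Definition _ := GRing.Zmodule_isLmodule.Build R tensor
  tscaleA tscale1 tscaleDr tscaleDl.

Lemma tliftE W (f : U -> V -> W) u v : bilin f -> tlift f (tens u v) = f u v.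
Proof. by move=> bf; rewrite tlift_pi// /fsum big_seq1. Qed.

Lemma tlift_linear W (f : U -> V -> W) : bilin f -> linear (tlift f).
Proof. by move=> bf c x y; rewrite tliftD_// tliftZ_. Qed.

Lemma tens_bilin : bilin tens.
Proof.
split=> [v c x y|u c x y]; apply: tensorP => W f bf;
  by rewrite tlift_linear// !tliftE// ?bf.1 ?bf.2.
Qed.

Lemma tensor_ind (P : tensor -> Prop) :
  P 0 -> (forall x y, P x -> P y -> P (x + y)) ->
  (forall u v, P (tens u v)) -> forall x, P x.
Proof.
move=> P0 PD Pt x; rewrite -[x]reprK; elim: (repr x) => [//|[u v] s IH].
have -> : \pi_tensor ((u, v) :: s) = tens u v + \pi_tensor s.
  apply: tensorP => W f bf; rewrite tliftD_// tliftE// !tlift_pi// /fsum.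
  by rewrite big_cons.
exact: PD.
Qed.

Lemma linear_map0 (X Y : lmodType R) (g : X -> Y) : linear g -> g 0 = 0.
Proof. by move=> lg; have := lg (-1) 0 0; rewrite scaler0 addr0 scaleN1r addNr. Qed.

Lemma tensor_ext W (g h : tensor -> W) : linear g -> linear h ->
  (forall u v, g (tens u v) = h (tens u v)) -> g =1 h.
Proof.
move=> lg lh e; apply: tensor_ind => //.
- by rewrite !linear_map0.
- by move=> x y gx gy; have:= lg 1 x y; have:= lh 1 x y;
    rewrite !scale1r => -> ->; rewrite gx gy.
Qed.

End Tensor.

Section TensorMaps.
Variable R : comNzRingType.

Lemma bilin_comp (U V W W' : lmodType R) (f : U -> V -> W) (g : W -> W') :
  bilin f -> linear g -> bilin (fun u v => g (f u v)).
Proof.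
move=> bf lg; split=> [v|u] c x y /=; rewrite -lg; congr g.
- exact: bf.1.
- exact: bf.2.
Qed.

Lemma bilin_pre (U V U' V' W : lmodType R) (f : U -> V -> W)
    (g : U' -> U) (h : V' -> V) :
  bilin f -> linear g -> linear h -> bilin (fun u v => f (g u) (h v)).
Proof.
move=> bf lg lh; split=> [v|u] c x y /=.
- by rewrite lg; exact: bf.1.
- by rewrite lh; exact: bf.2.
Qed.

Definition tmap (U V U' V' : lmodType R) (f : U -> U') (g : V -> V') :
    tensor U V -> tensor U' V' :=
  tlift (fun u v => tens (f u) (g v)).

Lemma tmap_bilin (U V U' V' : lmodType R) (f : U -> U') (g : V -> V') :
  linear f -> linear g -> bilin (fun u v => tens (f u) (g v)).
Proof. exact/bilin_pre/tens_bilin. Qed.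

Lemma tmapE (U V U' V' : lmodType R) (f : U -> U') (g : V -> V') u v :
  linear f -> linear g -> tmap f g (tens u v) = tens (f u) (g v).
Proof. by move=> lf lg; rewrite /tmap tliftE//; exact: tmap_bilin. Qed.

Lemma tmap_linear (U V U' V' : lmodType R) (f : U -> U') (g : V -> V') :
  linear f -> linear g -> linear (tmap f g).
Proof. by move=> lf lg; apply/tlift_linear/tmap_bilin. Qed.

(* the canonical map [x (x) (y (x) z) |-> (x (x) y) (x) z] *)
Definition tassoc (U V W : lmodType R) :
    tensor U (tensor V W) -> tensor (tensor U V) W :=
  tlift (fun u => tlift (fun v w => tens (tens u v) w)).

Lemma tlift_linear_fam (U V W X : lmodType R) (f : X -> U -> V -> W) :
  (forall x, bilin (f x)) ->
  (forall u v, linear (fun x => f x u v)) ->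
  forall t, linear (fun x => tlift (f x) t).
Proof.
move=> bf lf t c x y; move: t; apply: tensor_ext.
- exact: tlift_linear.
- move=> d s t; rewrite !tlift_linear// !scalerDr !scalerA addrACA.
  by rewrite [c * d]mulrC.
- by move=> u v; rewrite !tliftE//; exact: lf.
Qed.

Lemma tlift_tlift_bilin (U V U' V' W : lmodType R)
    (f : U -> V -> U' -> V' -> W) :
  (forall u v, bilin (f u v)) -> (forall u' v', bilin (fun u v => f u v u' v')) ->
  bilin (fun x y => tlift (fun u v => tlift (f u v) y) x).
Proof.
move=> b1 b2.
have b y : bilin (fun u v => tlift (f u v) y).
  by split=> [v|u]; apply: tlift_linear_fam => // u' v';
    [exact: (b2 u' v').1 | exact: (b2 u' v').2].
split=> [y|x]; first exact: tlift_linear.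
by apply: tlift_linear_fam => [//|u v]; exact: tlift_linear.
Qed.

End TensorMaps.

HB.mixin Record isStarAlgebra (C : numClosedFieldType) A
    of GRing.Lmodule C A := {
  smul : A -> A -> A;
  star : A -> A;
  smulA : associative smul;
  smul_bilin : bilin smul;
  star_conj : forall (c : C) x y, star (c *: x + y) = c^* *: star x + star y;
  starK : involutive star;
  starM : forall x y, star (smul x y) = smul (star y) (star x) }.

#[short(type="starAlgType")]
HB.structure Definition StarAlgebra (C : numClosedFieldType) :=
  {A of GRing.Lmodule C A & isStarAlgebra C A}.

Notation "x ** y" := (smul x y) (at level 40, left associativity) : ring_scope.

Section StarAlgebraTheory.
Variables (C : numClosedFieldType) (A : starAlgType C).
Implicit Types x y z : A.

Lemma starD x y : star (x + y) = star x + star y.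
Proof. by rewrite -[x]scale1r star_conj conjC1 !scale1r. Qed.

Lemma star0 : star (0 : A) = 0.
Proof. by apply: (addrI (star 0)); rewrite -starD !addr0. Qed.

Lemma starZ (c : C) x : star (c *: x) = c^* *: star x.
Proof. by rewrite -[c *: x]addr0 star_conj star0 addr0. Qed.

Definition nondegenerate_product :=
  (forall x, (forall y, x ** y = 0) -> x = 0) /\
  (forall x, (forall y, y ** x = 0) -> x = 0).

End StarAlgebraTheory.

Definition star_hom (C : numClosedFieldType) (A B : starAlgType C) (f : A -> B) :=
  [/\ linear f, forall x y, f (x ** y) = f x ** f y &
      forall x, f (star x) = star (f x)].

(* the complex conjugate of [V]: antilinear maps to [V] are linear maps to
   [conj_mod V] *)
Definition conj_mod (C : numClosedFieldType) (V : lmodType C) : Type := V.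

Section ConjMod.
Variables (C : numClosedFieldType) (V : lmodType C).
HB.instance Definition _ := GRing.Zmodule.on (conj_mod V).

Definition conj_scale (c : C) (v : conj_mod V) : conj_mod V := c^* *: (v : V).

Lemma conj_scaleA a b v : conj_scale a (conj_scale b v) = conj_scale (a * b) v.
Proof. by rewrite /conj_scale scalerA rmorphM. Qed.
Lemma conj_scale1 : left_id 1 conj_scale.
Proof. by move=> v; rewrite /conj_scale conjC1 scale1r. Qed.
Lemma conj_scaleDr : right_distributive conj_scale +%R.
Proof. by move=> a v w; exact: scalerDr. Qed.
Lemma conj_scaleDl v : {morph conj_scale^~ v : a b / a + b}.
Proof. by move=> a b; rewrite /conj_scale rmorphD scalerDl. Qed.
HB.instance Definition _ := GRing.Zmodule_isLmodule.Build C (conj_mod V)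
  conj_scaleA conj_scale1 conj_scaleDr conj_scaleDl.
End ConjMod.

Section TensorStar.
Variables (C : numClosedFieldType) (A B : starAlgType C).
Local Notation T := (tensor A B).

Definition tensor_mul (x y : T) : T :=
  tlift (fun a b => tlift (fun a' b' => tens (a ** a') (b ** b')) y) x.

Definition tensor_star : T -> T :=
  @tlift C A B (conj_mod T) (fun a b => tens (star a) (star b)).

Lemma smul_linl (D : starAlgType C) (y : D) : linear (fun x => x ** y).
Proof. exact: (smul_bilin.1 y). Qed.
Lemma smul_linr (D : starAlgType C) (x : D) : linear (fun y => x ** y).
Proof. exact: (smul_bilin.2 x). Qed.

Lemma tensor_mul_bilin : bilin tensor_mul.
Proof.
apply: tlift_tlift_bilin => a b; apply: (bilin_pre (tens_bilin _ _)).
- exact: smul_linr.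
- exact: smul_linr.
- exact: smul_linl.
- exact: smul_linl.
Qed.

Lemma tensor_mulE a b a' b' :
  tensor_mul (tens a b) (tens a' b') = tens (a ** a') (b ** b').
Proof.
have b1 (x : A) (y : B) : bilin (fun a b => tens (x ** a) (y ** b)).
  by apply: (bilin_pre (tens_bilin _ _)); exact: smul_linr.
have b2 (x : A) (y : B) : bilin (fun a b => tens (a ** x) (b ** y)).
  by apply: (bilin_pre (tens_bilin _ _)); exact: smul_linl.
rewrite /tensor_mul tliftE ?tliftE//.
by split=> [v|u]; apply: tlift_linear_fam => // u' v';
  [exact: (b2 u' v').1 | exact: (b2 u' v').2].
Qed.

Lemma tensor_star_bilin :
  @bilin C A B (conj_mod T) (fun a b => tens (star a) (star b)).
Proof.
split=> [b c x y|a c x y]; rewrite star_conj; [exact: (tens_bilin _ _).1|].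
exact: (tens_bilin _ _).2.
Qed.

Lemma tensor_starE a b : tensor_star (tens a b) = tens (star a) (star b).
Proof. exact: tliftE tensor_star_bilin. Qed.

Lemma tensor_star_conj (c : C) x y :
  tensor_star (c *: x + y) = c^* *: tensor_star x + tensor_star y.
Proof. exact: (tlift_linear tensor_star_bilin). Qed.

Lemma tensor_starD x y : tensor_star (x + y) = tensor_star x + tensor_star y.
Proof. by have := tensor_star_conj 1 x y; rewrite conjC1 !scale1r. Qed.

Lemma tensor_star0 : tensor_star 0 = 0.
Proof. by apply: (addrI (tensor_star 0)); rewrite -tensor_starD !addr0. Qed.

Lemma tensor_mulDl x y z :
  tensor_mul (x + y) z = tensor_mul x z + tensor_mul y z.
Proof. by have := tensor_mul_bilin.1 z 1 x y; rewrite !scale1r. Qed.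

Lemma tensor_mulDr x y z :
  tensor_mul z (x + y) = tensor_mul z x + tensor_mul z y.
Proof. by have := tensor_mul_bilin.2 z 1 x y; rewrite !scale1r. Qed.

Lemma tensor_mul0l z : tensor_mul 0 z = 0.
Proof. by apply: (addrI (tensor_mul 0 z)); rewrite -tensor_mulDl !addr0. Qed.

Lemma tensor_mul0r z : tensor_mul z 0 = 0.
Proof. by apply: (addrI (tensor_mul z 0)); rewrite -tensor_mulDr !addr0. Qed.

Lemma tensor_mulA : associative tensor_mul.
Proof.
move=> x y z; elim/tensor_ind: x => [|x x' ? ?|a b]; rewrite ?tensor_mul0l//.
  by rewrite !tensor_mulDl; congr (_ + _).
elim/tensor_ind: y => [|y y' ? ?|a' b'].
- by rewrite !(tensor_mul0l, tensor_mul0r).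
- by rewrite !(tensor_mulDl, tensor_mulDr); congr (_ + _).
elim/tensor_ind: z => [|z z' ? ?|a'' b'']; rewrite ?tensor_mul0r//.
  by rewrite !tensor_mulDr; congr (_ + _).
by rewrite !tensor_mulE !smulA.
Qed.

Lemma tensor_starK : involutive tensor_star.
Proof.
elim/tensor_ind => [|x y hx hy|a b]; first by rewrite !tensor_star0.
  by rewrite !tensor_starD hx hy.
by rewrite !tensor_starE !starK.
Qed.

Lemma tensor_starM x y :
  tensor_star (tensor_mul x y) = tensor_mul (tensor_star y) (tensor_star x).
Proof.
elim/tensor_ind: x => [|x x' hx hx'|a b].
- by rewrite tensor_mul0l tensor_star0 tensor_mul0r.
- by rewrite tensor_mulDl !tensor_starD tensor_mulDr hx hx'.
elim/tensor_ind: y => [|y y' hy hy'|a' b'].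
- by rewrite tensor_mul0r tensor_star0 tensor_mul0l.
- by rewrite tensor_mulDr !tensor_starD tensor_mulDl hy hy'.
by rewrite !(tensor_mulE, tensor_starE) !starM.
Qed.

HB.instance Definition _ := isStarAlgebra.Build C (tensor A B)
  tensor_mulA tensor_mul_bilin tensor_star_conj tensor_starK tensor_starM.

End TensorStar.

Section Multiplier.
Variables (C : numClosedFieldType) (A : starAlgType C).

(* [m] is represented by the pair of [x |-> m x] and [x |-> x m] *)
Definition is_mult (m : (A -> A) * (A -> A)) : Prop :=
  [/\ linear m.1, linear m.2,
      forall x y, m.1 (x ** y) = m.1 x ** y,
      forall x y, m.2 (x ** y) = x ** m.2 y &
      forall x y, m.2 x ** y = x ** m.1 y].

Definition mult_pred : pred ((A -> A) * (A -> A)) := fun m => `[< is_mult m >].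

Record mult := Mult { mult_val : (A -> A) * (A -> A); _ : mult_val \in mult_pred }.

HB.instance Definition _ := [isSub for mult_val].
HB.instance Definition _ := [Choice of mult by <:].

Lemma multP (m : mult) : is_mult (mult_val m).
Proof. by case: m => m /= /asboolP. Qed.

Lemma linear_comb (f g : A -> A) (c : C) :
  linear f -> linear g -> linear (c *: f + g).
Proof.
move=> lf lg d x y; rewrite !fctE lf lg !scalerDr addrACA !scalerA.
by rewrite [c * d]mulrC.
Qed.

Lemma mult_submod : submod_closed mult_pred.
Proof.
split=> [|c m n /asboolP[m1 m2 m3 m4 m5] /asboolP[n1 n2 n3 n4 n5]]; apply/asboolP.
  split=> /= [c x y|c x y|x y|x y|x y]; rewrite ?fctE ?scaler0 ?addr0//.
  - by rewrite (linear_map0 (smul_linl y)).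
  - by rewrite (linear_map0 (smul_linr x)).
  - by rewrite (linear_map0 (smul_linl y)) (linear_map0 (smul_linr x)).
have sl (x y z : A) : (c *: x + y) ** z = c *: (x ** z) + y ** z.
  exact: smul_linl.
have sr (x y z : A) : z ** (c *: x + y) = c *: (z ** x) + z ** y.
  exact: smul_linr.
split=> /= [||x y|x y|x y]; try exact: linear_comb.
- by rewrite !fctE sl m3 n3.
- by rewrite !fctE sr m4 n4.
- by rewrite !fctE sl sr m5 n5.
Qed.

HB.instance Definition _ :=
  GRing.isSubmodClosed.Build C ((A -> A) * (A -> A))%type mult_pred mult_submod.
HB.instance Definition _ := [SubChoice_isSubLmodule of mult by <:].

Definition lmul (m : mult) (x : A) : A := (mult_val m).1 x.
Definition rmul (m : mult) (x : A) : A := (mult_val m).2 x.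

Lemma lmul_linear m : linear (lmul m). Proof. by case: (multP m). Qed.
Lemma rmul_linear m : linear (rmul m). Proof. by case: (multP m). Qed.
Lemma lmulM m x y : lmul m (x ** y) = lmul m x ** y.
Proof. by case: (multP m) => _ _ h _ _; exact: h. Qed.
Lemma rmulM m x y : rmul m (x ** y) = x ** rmul m y.
Proof. by case: (multP m) => _ _ _ h _; exact: h. Qed.
Lemma rmul_lmul m x y : rmul m x ** y = x ** lmul m y.
Proof. by case: (multP m) => _ _ _ _ h; exact: h. Qed.

Lemma multE (m n : mult) : lmul m =1 lmul n -> rmul m =1 rmul n -> m = n.
Proof.
move=> /funext l /funext r; apply: val_inj => /=.
rewrite [LHS]surjective_pairing [RHS]surjective_pairing.
exact: (f_equal2 pair).
Qed.

Lemma is_mult_in m : is_mult m -> m \in mult_pred.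
Proof. by move=> h; apply/asboolP. Qed.

Lemma is_mult_mul (m n : mult) :
  is_mult (lmul m \o lmul n, rmul n \o rmul m).
Proof.
split=> /= [c x y|c x y|x y|x y|x y].
- by rewrite /= !lmul_linear.
- by rewrite /= !rmul_linear.
- by rewrite !lmulM.
- by rewrite !rmulM.
- by rewrite !rmul_lmul.
Qed.
Definition mult_mul m n := Mult (is_mult_in (is_mult_mul m n)).

Lemma is_mult_star (m : mult) :
  is_mult (fun x => star (rmul m (star x)), fun x => star (lmul m (star x))).
Proof.
split=> /= [c x y|c x y|x y|x y|x y].
- by rewrite star_conj rmul_linear star_conj conjCK.
- by rewrite star_conj lmul_linear star_conj conjCK.
- by rewrite starM rmulM starM starK.
- by rewrite starM lmulM starM starK.
- by rewrite -[y in LHS]starK -starM -rmul_lmul starM starK.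
Qed.
Definition mult_star m := Mult (is_mult_in (is_mult_star m)).

Lemma mult_mulA : associative mult_mul.
Proof. by move=> l m n; apply: multE. Qed.

Lemma mult_combE (c : C) (m n : mult) :
  (lmul (c *: m + n) =1 (fun x => c *: lmul m x + lmul n x)) *
  (rmul (c *: m + n) =1 (fun x => c *: rmul m x + rmul n x)).
Proof. by split=> x; rewrite /lmul /rmul/=. Qed.

Lemma mult_mul_bilin : bilin mult_mul.
Proof.
split=> [n c l m|l c m n]; apply: multE => x; rewrite mult_combE/lmul/rmul/=.
- exact: (mult_combE c l m).1.
- by rewrite -[LHS]/(rmul n (rmul (c *: l + m) x)) mult_combE rmul_linear.
- by rewrite -[LHS]/(lmul l (lmul (c *: m + n) x)) mult_combE lmul_linear.
- exact: (mult_combE c m n).2.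
Qed.

Lemma mult_star_conj (c : C) m n :
  mult_star (c *: m + n) = c^* *: mult_star m + mult_star n.
Proof.
apply: multE => x; rewrite mult_combE.
- by rewrite -[LHS]/(star (rmul (c *: m + n) (star x))) mult_combE star_conj.
- by rewrite -[LHS]/(star (lmul (c *: m + n) (star x))) mult_combE star_conj.
Qed.

Lemma mult_starK : involutive mult_star.
Proof. by move=> m; apply: multE => x; rewrite /lmul/rmul/= !starK. Qed.

Lemma mult_starM m n :
  mult_star (mult_mul m n) = mult_mul (mult_star n) (mult_star m).
Proof.
apply: multE => x.
- rewrite -[RHS]/(star (rmul n (star (star (rmul m (star x)))))).
  by rewrite starK.
- rewrite -[RHS]/(star (lmul m (star (star (lmul n (star x)))))).
  by rewrite starK.
Qed.

HB.instance Definition _ := isStarAlgebra.Build C mult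
  mult_mulA mult_mul_bilin mult_star_conj mult_starK mult_starM.

Lemma is_mult1 : is_mult (id, id).
Proof. by split. Qed.
Definition mult1 := Mult (is_mult_in is_mult1).

Lemma is_mult_emb (a : A) : is_mult (fun x => a ** x, fun x => x ** a).
Proof.
by split=> [||x y|x y|x y] /=; rewrite ?smulA//; [exact: smul_linr|exact: smul_linl].
Qed.
Definition emb a := Mult (is_mult_in (is_mult_emb a)).

End Multiplier.

Section MultTensor.
Variables (C : numClosedFieldType) (A B : starAlgType C).

Lemma is_mult_tens (m : mult A) (n : mult B) :
  is_mult (tmap (lmul m) (lmul n), tmap (rmul m) (rmul n)).
Proof.
have ll := tmap_linear (lmul_linear m) (lmul_linear n).
have rl := tmap_linear (rmul_linear m) (rmul_linear n).
have e0 := (linear_map0 ll, linear_map0 rl).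
have eD : (forall x y, tmap (lmul m) (lmul n) (x + y) =
    tmap (lmul m) (lmul n) x + tmap (lmul m) (lmul n) y) *
  (forall x y, tmap (rmul m) (rmul n) (x + y) =
    tmap (rmul m) (rmul n) x + tmap (rmul m) (rmul n) y).
  by split=> x y; [have := ll 1 x y | have := rl 1 x y]; rewrite !scale1r.
have mD : (forall x y z : tensor A B, (x + y) ** z = x ** z + y ** z) *
          (forall x y z : tensor A B, z ** (x + y) = z ** x + z ** y).
  by split=> x y z; [exact: tensor_mulDl|exact: tensor_mulDr].
have m0 : (forall z : tensor A B, 0 ** z = 0) * (forall z : tensor A B, z ** 0 = 0).
  by split=> z; [exact: tensor_mul0l|exact: tensor_mul0r].
have mE a b a' b' : (tens a b : tensor A B) ** tens a' b' =
    tens (a ** a') (b ** b') by exact: tensor_mulE.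
have tE := (fun a b => tmapE a b (lmul_linear m) (lmul_linear n),
            fun a b => tmapE a b (rmul_linear m) (rmul_linear n)).
split=> /= [||x y|x y|x y].
- exact: ll.
- exact: rl.
- elim/tensor_ind: x => [|x x' h h'|a b]; rewrite ?(m0, e0)//.
    by rewrite !(mD, eD) h h'.
  elim/tensor_ind: y => [|y y' h h'|a' b']; rewrite ?(m0, e0)//.
    by rewrite !(mD, eD) h h'.
  by rewrite !(mE, tE) !lmulM.
- elim/tensor_ind: x => [|x x' h h'|a b]; rewrite ?(m0, e0)//.
    by rewrite !(mD, eD) h h'.
  elim/tensor_ind: y => [|y y' h h'|a' b']; rewrite ?(m0, e0)//.
    by rewrite !(mD, eD) ?mD h h'.
  by rewrite !(mE, tE) !rmulM.
- elim/tensor_ind: x => [|x x' h h'|a b]; rewrite ?(m0, e0)//.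
    by rewrite !(mD, eD) ?mD h h'.
  elim/tensor_ind: y => [|y y' h h'|a' b']; rewrite ?(m0, e0)//.
    by rewrite !(mD, eD) ?mD h h'.
  by rewrite !(mE, tE) ?mE !rmul_lmul.
Qed.
Definition mtens m n := Mult (is_mult_in (is_mult_tens m n)).

End MultTensor.
Arguments mult1 {C A}.

Section MultiplierHopf.
Variables (C : numClosedFieldType) (A : starAlgType C).
Variable Delta : A -> mult (tensor A A).

(* [(Delta (x) iota) u] and [(iota (x) Delta) v] in the multiplier algebras of
   [(A (x) A) (x) A] and [A (x) (A (x) A)]. *)
Definition Delta_iota (u : tensor A A) : mult (tensor (tensor A A) A) :=
  tlift (fun p q => mtens (Delta p) (emb q)) u.
Definition iota_Delta (v : tensor A A) : mult (tensor A (tensor A A)) :=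
  tlift (fun p q => mtens (emb p) (Delta q)) v.

Definition same_mult3 (m : mult (tensor (tensor A A) A))
    (n : mult (tensor A (tensor A A))) :=
  forall w, lmul m (tassoc w) = tassoc (lmul n w) /\
            rmul m (tassoc w) = tassoc (rmul n w).

(* (a (x) 1 (x) 1) (Delta (x) iota)(Delta(b) (1 (x) c))
     = (iota (x) Delta)((a (x) 1) Delta(b)) (1 (x) 1 (x) c);
   this form only applies [Delta (x) iota] and [iota (x) Delta] to elements of
   [A (x) A], so it makes sense without extending them to [M(A (x) A)]. *)
Definition coassociative := forall (a b c : A) (u v : tensor A A),
  emb u = Delta b ** mtens mult1 (emb c) ->
  emb v = mtens (emb a) mult1 ** Delta b ->
  same_mult3 (mtens (mtens (emb a) mult1) mult1 ** Delta_iota u)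
             (iota_Delta v ** mtens mult1 (mtens mult1 (emb c))).

Record mult_hopf_star : Prop := MultHopfStar {
  mhs_nondegenerate : nondegenerate_product A;
  mhs_star_hom : star_hom Delta;
  mhs_bij_r : exists T : tensor A A -> tensor A A,
    [/\ linear T, bijective T &
     forall a b, emb (T (tens a b)) = Delta a ** mtens mult1 (emb b)];
  mhs_bij_l : exists T : tensor A A -> tensor A A,
    [/\ linear T, bijective T &
     forall a b, emb (T (tens a b)) = mtens (emb a) mult1 ** Delta b];
  mhs_coassociative : coassociative }.

Definition iota_fun (phi : A -> C) : tensor A A -> A :=
  tlift (fun a b => phi b *: a).
Definition fun_iota (psi : A -> C) : tensor A A -> A :=
  tlift (fun a b => psi a *: b).

(* [n = (iota (x) phi) m], resp. [n = (psi (x) iota) m], in [M(A)]: the slice of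
   [m] is the multiplier [n] with [n a = (iota (x) phi)(m (a (x) 1))] and
   [a n = (iota (x) phi)((a (x) 1) m)]. *)
Definition is_iota_fun (phi : A -> C) (m : mult (tensor A A)) (n : mult A) :=
  forall a,
    (exists2 w, emb w = m ** mtens (emb a) mult1 &
                emb (iota_fun phi w) = n ** emb a) /\
    (exists2 w, emb w = mtens (emb a) mult1 ** m &
                emb (iota_fun phi w) = emb a ** n).
Definition is_fun_iota (psi : A -> C) (m : mult (tensor A A)) (n : mult A) :=
  forall a,
    (exists2 w, emb w = m ** mtens mult1 (emb a) &
                emb (fun_iota psi w) = n ** emb a) /\
    (exists2 w, emb w = mtens mult1 (emb a) ** m &
                emb (fun_iota psi w) = emb a ** n).

Definition left_integral (phi : {scalar A}) :=
  (exists a, phi a != 0) /\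
  forall a, is_iota_fun phi (Delta a) (phi a *: mult1).
Definition right_integral (psi : {scalar A}) :=
  (exists a, psi a != 0) /\
  forall a, is_fun_iota psi (Delta a) (psi a *: mult1).

Definition positive_functional (w : {scalar A}) :=
  forall a, 0 <= w (star a ** a).

End MultiplierHopf.

(* The inner product is linear in its first argument. *)
HB.mixin Record CompleteNormedModule_isHilbert (C : numClosedFieldType) H
    of CompleteNormedModule C H := {
  dot : H -> H -> C;
  dot_scalar : forall y, scalar (dot^~ y);
  dot_conj : forall x y, dot x y = (dot y x)^*;
  dot_norm : forall x, dot x x = `|x| ^+ 2 }.

#[short(type="hilbertType")]
HB.structure Definition Hilbert (C : numClosedFieldType) :=
  {H of CompleteNormedModule C H & CompleteNormedModule_isHilbert C H}.

Section BoundedOperators.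
Variables (C : numClosedFieldType) (H K : hilbertType C).

Definition bop_pred : pred (H -> K) :=
  fun f => `[< linear f /\ continuous f >].

Record bop := Bop { bop_val :> H -> K; _ : bop_val \in bop_pred }.
HB.instance Definition _ := [isSub for bop_val].
HB.instance Definition _ := [Choice of bop by <:].

Lemma bop_linear (T : bop) : linear T.
Proof. by case: T => f /= /asboolP[]. Qed.
Lemma bop_continuous (T : bop) : continuous T.
Proof. by case: T => f /= /asboolP[]. Qed.

Lemma bop_submod : submod_closed bop_pred.
Proof.
split=> [|c f g /asboolP[lf cf] /asboolP[lg cg]]; apply/asboolP.
  split=> [c x y|x]; first by rewrite [LHS](_ : _ = 0)// scaler0 addr0.
  exact: cst_continuous.
split=> [d x y|x]; last first.
  have : c *: f y + g y @[y --> x] --> c *: f x + g x.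
    by apply: cvgD; [apply: cvgZl_tmp; exact: cf | exact: cg].
  exact.
by rewrite !fctE lf lg !scalerDr addrACA !scalerA [c * d]mulrC.
Qed.

HB.instance Definition _ :=
  GRing.isSubmodClosed.Build C (H -> K) bop_pred bop_submod.
HB.instance Definition _ := [SubChoice_isSubLmodule of bop by <:].

End BoundedOperators.

Lemma bop_comp_subproof (C : numClosedFieldType) (H K L : hilbertType C)
    (S : bop K L) (T : bop H K) : S \o T \in @bop_pred C H L.
Proof.
apply/asboolP; split=> [c x y|x] /=; first by rewrite !bop_linear.
by apply: continuous_comp; apply: bop_continuous.
Qed.
Definition bop_comp (C : numClosedFieldType) (H K L : hilbertType C)
    (S : bop K L) (T : bop H K) : bop H L := Bop (bop_comp_subproof S T).

(* [xget 0] below picks the unique bounded operator with the given property. *)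
Definition adjoint (C : numClosedFieldType) (H K : hilbertType C)
    (T : bop H K) : bop K H :=
  xget 0 [set S : bop K H | forall x y, dot (T x) y = dot x (S y)].

Section Closures.
Variables (C : numClosedFieldType) (H : hilbertType C).
Implicit Types X : set (bop H H).

Definition norm_closure X : set (bop H H) :=
  [set T | forall e : C, 0 < e ->
    exists2 S, X S & forall x, `|T x - S x| <= e * `|x|].

Definition weak_closure X : set (bop H H) :=
  [set T | forall (s : seq (H * H)) (e : C), 0 < e ->
    exists2 S, X S & forall p, p \in s -> `|dot (T p.1 - S p.1) p.2| < e].

(* The sigma-weak topology on [B(H)] is defined by the seminorms
   [T |-> |\sum_n <T xi_n, eta_n>|] with [xi], [eta] square-summable; a linear
   functional is normal when it is continuous for it. *)
Definition square_summable (xi : nat -> H) :=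
  exists M : C, forall n, \sum_(k < n) `|xi k| ^+ 2 <= M.

Definition sigma_weak (p : (nat -> H) * (nat -> H)) (T : bop H H) : C :=
  lim ((series (fun n => dot (T (p.1 n)) (p.2 n)) : nat -> C^o) @ \oo).

Definition normal (w : {scalar (bop H H)}) :=
  exists2 s : seq ((nat -> H) * (nat -> H)),
    (forall i, (i < size s)%N ->
       square_summable (nth (fun=> 0, fun=> 0) s i).1 /\
       square_summable (nth (fun=> 0, fun=> 0) s i).2) &
    exists M : C, forall T, `|w T| <= M * \sum_(p <- s) `|sigma_weak p T|.

End Closures.

Record gns_completion (C : numClosedFieldType) (A : starAlgType C)
    (psi : {scalar A}) := GNSCompletion {
  gns_hilbert :> hilbertType C;
  Lambda : A -> gns_hilbert;
  Lambda_linear : linear Lambda;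
  Lambda_dot : forall a a', dot (Lambda a') (Lambda a) = psi (star a ** a');
  Lambda_dense : dense (range Lambda) }.

(* [ht_map] is the canonical map from the algebraic to the completed tensor
   product. *)
Record hilbert_tensor (C : numClosedFieldType) (H H' : hilbertType C) :=
    HilbertTensor {
  ht_hilbert :> hilbertType C;
  ht_map : tensor H H' -> ht_hilbert;
  ht_linear : linear ht_map;
  ht_dot : forall x x' y y', dot (ht_map (tens x x')) (ht_map (tens y y')) =
                             dot x y * dot x' y';
  ht_dense : dense (range ht_map) }.

(* A set of operators on [H] with a coproduct given by its graph, with values in
   the operators on [K] (the Hilbert tensor square of [H]). *)
Record operator_bialgebra (C : numClosedFieldType) (H K : hilbertType C) :=
    OperatorBialgebra {
  ob_carrier : set (bop H H);
  ob_coproduct : set (bop H H * bop K K) }.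

Definition ob_restrict (C : numClosedFieldType) (H K : hilbertType C)
    (N : operator_bialgebra H K) (X : set (bop H H)) : operator_bialgebra H K :=
  OperatorBialgebra X [set p | ob_coproduct N p /\ X p.1].

Section Slices.
Variables (C : numClosedFieldType) (H : hilbertType C) (K : hilbert_tensor H H).
Implicit Types (V : bop K K) (w : {scalar (bop H H)}).

(* [x (x) 1] *)
Definition amplification (x : bop H H) : bop K K :=
  xget 0 [set T : bop K K | forall xi eta : H,
    T (ht_map K (tens xi eta)) = ht_map K (tens (x xi) eta)].

(* [(iota (x) w_{xi,eta}) V], with [w_{xi,eta} T = <T xi, eta>] *)
Definition vector_slice V (xi eta : H) : bop H H :=
  xget 0 [set S : bop H H | forall z z' : H,
    dot (S z) z' = dot (V (ht_map K (tens z xi))) (ht_map K (tens z' eta))].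

(* [(w (x) iota) V], through [w_{xi,eta}((w (x) iota) V) =
   w((iota (x) w_{xi,eta}) V)] *)
Definition slice w V : bop H H :=
  xget 0 [set T : bop H H | forall xi eta : H,
    dot (T xi) eta = w (vector_slice V xi eta)].

(* the C*-algebraic quantum group of a von Neumann algebraic quantum group [N]
   with right regular representation [V] *)
Definition cstar_quantum_group (N : operator_bialgebra H K) V :
    operator_bialgebra H K :=
  ob_restrict N (norm_closure [set slice w V | w in @normal C H]).

End Slices.

Section Completion.
Variables (C : numClosedFieldType) (A : starAlgType C).
Variables (Delta : A -> mult (tensor A A)) (psi : {scalar A}).
Variables (H : gns_completion psi) (K : hilbert_tensor H H).

Definition gns_action (a : A) : bop H H :=
  xget 0 [set T : bop H H | forall x, T (Lambda H x) = Lambda H (a ** x)].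

(* [V (Lambda x (x) Lambda x') = (Lambda (x) Lambda)(Delta(x) (1 (x) x'))] *)
Definition right_regular : bop K K :=
  xget 0 [set V : bop K K | forall x x' (u : tensor A A),
    emb u = Delta x ** mtens mult1 (emb x') ->
    V (ht_map K (tens (Lambda H x) (Lambda H x'))) =
      ht_map K (tmap (Lambda H) (Lambda H) u)].

Definition vn_carrier : set (bop H H) := weak_closure (range gns_action).

Definition vn_coproduct (x : bop H H) : bop K K :=
  bop_comp right_regular (bop_comp (amplification K x) (adjoint right_regular)).

Definition vn_quantum_group : operator_bialgebra H K :=
  OperatorBialgebra vn_carrier
    [set p | vn_carrier p.1 /\ p.2 = vn_coproduct p.1].

End Completion.

(* Main.v *)
Require Import Defs.
From HB Require Import structures.
From mathcomp Require Import all_boot all_order all_algebra complex.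
From mathcomp Require Import all_classical all_reals all_analysis.
From mathcomp Require Import ring.

Set Implicit Arguments.
Unset Strict Implicit.
Unset Printing Implicit Defensive.

Import Order.TTheory GRing.Theory Num.Theory.
Import numFieldNormedType.Exports.

Local Open Scope classical_set_scope.
Local Open Scope ring_scope.

(* The slice of [V] by the vector functional of [Lambda x] and [Lambda y] is left
   multiplication by [(psi (x) iota)((y^* (x) 1) Delta(x))], and these elements
   span [A] because [(A (x) 1) Delta(A) = A (x) A]. Hence [A] acts by bounded
   operators, each of them a slice of [V] by a finite sum of vector functionals.
   Conversely a normal functional is a limit, in the norm of the dual of [B(H)],
   of finite sums of vector functionals of vectors in [Lambda(A)], and slicing a
   bounded operator is norm continuous, so every normal slice of [V] is a norm
   limit of elements of [A]. *)

(** * Separation of algebraic tensors by functionals *)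

(** [gns_action], [right_regular] and [vector_slice] pick an operator by [xget] with default 0, so
    each is useful only once a bounded operator with the given property has been exhibited. Left
    multiplication is not visibly bounded for the norm of [psi]; the bound is drawn from [V], which
    is isometric by right invariance of [psi]. A second obstacle is that Delta(x)(1 (x) x') is given
    only as a multiplier of A (x) A, whereas [V] needs the tensor itself: [emb] must be injective on
    a quotient of formal sums, which calls for enough linear functionals and hence for Zorn's lemma.
    Finally, [normal] is a domination by sigma-weak seminorms; an argument on kernels makes of it a
    finite combination of convergent series. *)

Section SeparatingFunctionals.
Variable F : fieldType.

Definition subspace_set (V : lmodType F) (S : set V) :=
  S 0 /\ forall c x y, S x -> S y -> S (c *: x + y).

Lemma subspace_setZ (V : lmodType F) (S : set V) c x :
  subspace_set S -> S x -> S (c *: x).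
Proof. by move=> [S0 SD] Sx; rewrite -[_ *: _]addr0; exact: SD. Qed.

(** Zorn's lemma gives a subspace containing [S] and maximal among those missing [b]; modulo it
    every vector is a unique multiple of [b], and that coefficient is the functional. The order is
    put on the sets [X] added to [S], so that the empty chain is bounded too. *)
Lemma separating_functional (V : lmodType F) (S : set V) (b : V) :
  subspace_set S -> ~ S b ->
  exists2 f : V -> F^o, linear f & (forall s, S s -> f s = 0) /\ f b = 1.
Proof.
move=> hS Sb.
pose P := [set X : set V | subspace_set (S `|` X) /\ ~ (S `|` X) b].
have [N [[hN Nb] Nmax]] : exists N, P N /\ forall B, N `<` B -> ~ P B.
  apply: Zorn_bigcup => G GP Gtot; split; last first.
    by move=> [//|[X GX Xb]]; apply: (GP X GX).2; right.
  split=> [|c x y]; first by left; exact: hS.1.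
  case=> [Sx|[X GX Xx]] [Sy|[Y GY Yy]].
  - by left; exact: hS.2.
  - have [||?|?] := (GP Y GY).1.2 c x y; [by left|by right|by left|].
    by right; exists Y.
  - have [||?|?] := (GP X GX).1.2 c x y; [by right|by left|by left|].
    by right; exists X.
  - have [XY|YX] := Gtot _ _ GX GY.
      have [||?|?] := (GP Y GY).1.2 c x y; [right; exact: XY|by right|by left|].
      by right; exists Y.
    have [||?|?] := (GP X GX).1.2 c x y; [by right|right; exact: YX|by left|].
    by right; exists X.
set N' := S `|` N in hN Nb.
have NZ c x : N' x -> N' (c *: x) by exact: subspace_setZ.
have ND x y : N' x -> N' y -> N' (x + y).
  by move=> Nx Ny; rewrite -[x]scale1r; exact: hN.2.
have coef v : exists c, N' (v - c *: b).
  have [Nv|Nv] := pselect (N' v); first by exists 0; rewrite scale0r subr0.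
  (* [B] is the span of [N'] and [v]; maximality puts [b] in it, with a nonzero coefficient [d] on
     [v] since [b] is not in [N']. *)
  pose B := [set x | exists d, N' (x - d *: v)].
  have NB : N' `<=` B by move=> x Nx; exists 0; rewrite scale0r subr0.
  have eB : S `|` B = B.
    by apply/seteqP; split=> x; [case=> // Sx; apply: NB; left | right].
  have hB : subspace_set B.
    split=> [|c x y [d hd] [e he]]; first exact/NB/hN.1.
    exists (c * d + e).
    have -> : c *: x + y - (c * d + e) *: v = c *: (x - d *: v) + (y - e *: v).
      by rewrite scalerDl scalerBr scalerA opprD addrACA.
    exact: hN.2.
  have [d Nbd] : B b.
    apply: contrapT => Bb; apply: (Nmax B); last by split; rewrite eB.
    split; first by move=> x Nx; apply: NB; right.
    move=> BN; apply: Nv; right; apply: BN; exists 1.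
    by rewrite scale1r subrr; exact: hN.1.
  have d0 : d != 0.
    by apply: contra_not_neq Nb => d0; move: Nbd; rewrite d0 scale0r subr0.
  exists d^-1; rewrite -opprB -scaleN1r; apply: (NZ).
  rewrite -[v in _ - v]scale1r -(mulVf d0) -scalerA -scalerBr.
  exact: NZ.
have coef_uniq v c d : N' (v - c *: b) -> N' (v - d *: b) -> c = d.
  move=> hc hd; apply: contra_notP Nb => /eqP; rewrite -subr_eq0 => cd.
  have : N' ((c - d) *: b).
    have -> : (c - d) *: b = (v - d *: b) + (-1) *: (v - c *: b).
      by rewrite scaleN1r opprB scalerBl [RHS]addrC addrA subrK.
    by apply: ND => //; exact: NZ.
  by move=> /(NZ (c - d)^-1); rewrite scalerA mulVf// scale1r.
have [f fP] := choice coef.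
exists (f : V -> F^o); [|split].
- move=> c x y; apply: (coef_uniq (c *: x + y)) => //.
  have -> : c *: x + y - (c * f x + f y) *: b =
      c *: (x - f x *: b) + (y - f y *: b).
    by rewrite scalerDl -scalerA scalerBr opprD addrACA.
  exact: hN.2.
- move=> s Ss; apply: (coef_uniq s) => //; rewrite scale0r subr0; left => //.
- by apply: (coef_uniq b) => //; rewrite scale1r subrr; exact: hN.1.
Qed.

Lemma functionals_separate (V : lmodType F) (x : V) :
  (forall f : V -> F^o, linear f -> f x = 0) -> x = 0.
Proof.
move=> h; apply: contrapT => x0.
have [||f lf [_]] := @separating_functional V [set 0] x.
- by split=> // c y z -> ->; rewrite /= scaler0 addr0.
- exact: x0.
by rewrite h// => /esym/eqP; rewrite oner_eq0.
Qed.

Variables U V : lmodType F.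

Lemma slice_bilin (f : V -> F^o) : linear f ->
  bilin (fun (u : U) (v : V) => f v *: u).
Proof.
move=> lf; split=> [v|u] c x y; first by rewrite scalerDr !scalerA mulrC.
by rewrite lf scalerDl -scalerA.
Qed.

Lemma tensorE (x : tensor U V) : x = \sum_(p <- repr x) tens p.1 p.2.
Proof.
rewrite -[LHS]reprK; elim: (repr x) => [|[u v] s IH]; first by rewrite big_nil.
rewrite big_cons -IH; apply: tensorP => W f bf.
by rewrite tliftD_// tliftE// !tlift_pi// /fsum big_cons.
Qed.

Lemma tlift_sum (W : lmodType F) (f : U -> V -> W) (s : seq (U * V)) : bilin f ->
  tlift f (\sum_(p <- s) tens p.1 p.2) = \sum_(p <- s) f p.1 p.2.
Proof.
move=> bf; elim: s => [|p s IH]; rewrite ?(big_nil, big_cons).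
  exact/linear_map0/tlift_linear.
by rewrite tliftD_// tliftE// IH.
Qed.

(* Induction on the length of a representation of the tensor: either the second
   factor of the first term is a combination of the others, and the term can be
   absorbed, or a functional isolates it. *)
Lemma right_slices_separate (x : tensor U V) :
  (forall f : V -> F^o, linear f -> tlift (fun u v => f v *: u) x = 0) -> x = 0.
Proof.
rewrite [x]tensorE; have [n] := ubnP (size (repr x)).
elim: n (repr x : seq (U * V)) => // n IH [|[u v] s] /= sn h.
  by rewrite big_nil.
rewrite big_cons /=.
pose S := [set w : V | exists c : nat -> F,
  w = \sum_(i < size s) c i *: (nth (0, 0) s i).2].
have [[c vE]|vS] := pselect (S v).
  pose t := mkseq (fun i => ((nth (0, 0) s i).1 + c i *: u, (nth (0, 0) s i).2))
    (size s).
  have e : tens u v + \sum_(p <- s) tens p.1 p.2 = \sum_(p <- t) tens p.1 p.2.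
    apply: tensorP => W f bf; rewrite tliftD_// tliftE// !tlift_sum//.
    rewrite (big_nth (0, 0)) big_mkord [RHS](big_nth (0, 0)) big_mkord.
    rewrite size_mkseq vE.
    have lf : forall a x y, f u (a *: x + y) = a *: f u x + f u y by exact: bf.2.
    have -> : f u (\sum_(i < size s) c i *: (nth (0, 0) s i).2) =
        \sum_(i < size s) c i *: f u (nth (0, 0) s i).2.
      elim/big_rec2: _ => [|i y1 y2 _ <-]; last exact: lf.
      exact: linear_map0 (bf.2 u).
    rewrite -big_split; apply: eq_bigr => i _ /=.
    by rewrite nth_mkseq// [_ + c i *: u]addrC (bf.1 _).
  rewrite e; apply: IH; first by rewrite size_mkseq.
  by move=> f lf; have := h f lf; rewrite big_cons e.
have hS : subspace_set S.
  split=> [|d x1 y [c ->] [e ->]].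
    by exists (fun=> 0); rewrite big1// => i _; rewrite scale0r.
  exists (fun i => d * c i + e i); rewrite scaler_sumr -big_split.
  by apply: eq_bigr => i _ /=; rewrite scalerDl scalerA.
have [f lf [fS fv]] := separating_functional hS vS.
have u0 : u = 0.
  have := h f lf; rewrite big_cons tliftD_ ?tliftE ?tlift_sum;
    try exact: slice_bilin.
  rewrite /= fv scale1r (big_nth (0, 0)) big_mkord big1 ?addr0// => i _.
  rewrite fS ?scale0r//; exists (fun j => (j == i :> nat)%:R).
  rewrite (bigD1 i)//= eqxx scale1r big1 ?addr0// => j ji.
  by rewrite (negbTE (ji : j != i :> nat)) scale0r.
have u0E : tens u v = 0 :> tensor U V.
  by rewrite u0; exact: (linear_map0 ((tens_bilin U V).1 v)).
rewrite u0E add0r; apply: IH => // g lg.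
by have := h g lg; rewrite big_cons u0E add0r.
Qed.

Lemma functional_pair_bilin (f : U -> F^o) (g : V -> F^o) :
  linear f -> linear g -> bilin (fun u v => f u * g v : F^o).
Proof.
move=> lf lg; split=> [v|u] c x y.
- by rewrite lf mulrDl [_ *: (_ * _)]mulrA.
- by rewrite lg mulrDr [_ *: (_ * _)]mulrCA.
Qed.

Lemma functional_pairs_separate (x : tensor U V) :
  (forall f : U -> F^o, linear f -> forall g : V -> F^o, linear g ->
    tlift (fun u v => f u * g v : F^o) x = 0) -> x = 0.
Proof.
move=> h; apply: right_slices_separate => g lg.
apply: functionals_separate => f lf; rewrite -[RHS](h f lf g lg).
move: x {h}; apply: tensor_ext => [c x y|c x y|u v].
- by rewrite tlift_linear ?lf//; exact: slice_bilin.
- by rewrite tlift_linear//; exact: functional_pair_bilin.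
- rewrite !tliftE; [|exact: functional_pair_bilin|exact: slice_bilin].
  by have := lf (g v) u 0; rewrite addr0 (linear_map0 lf) addr0 mulrC.
Qed.

End SeparatingFunctionals.

(** * Transport of linear maps through tensor products *)

Section TensorLifts.
Variable R : comNzRingType.

Lemma tlift_tmap (U V U' V' W : lmodType R) (g : U -> U') (h : V -> V')
    (f : U' -> V' -> W) x : bilin f -> linear g -> linear h ->
  tlift f (tmap g h x) = tlift (fun u v => f (g u) (h v)) x.
Proof.
move=> bf lg lh; move: x; apply: tensor_ext => [c x y|c x y|u v].
- by rewrite tmap_linear// tlift_linear.
- by rewrite tlift_linear//; exact: bilin_pre.
- by rewrite tmapE// !tliftE//; exact: bilin_pre.
Qed.

Lemma linear_tlift (U V W W' : lmodType R) (f : U -> V -> W) (k : W -> W') x :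
  bilin f -> linear k -> k (tlift f x) = tlift (fun u v => k (f u v)) x.
Proof.
move=> bf lk; move: x; apply: tensor_ext => [c x y|c x y|u v].
- by rewrite tlift_linear// lk.
- by rewrite tlift_linear//; exact: bilin_comp.
- by rewrite !tliftE//; exact: bilin_comp.
Qed.

Lemma eq_tlift (U V W : lmodType R) (f g : U -> V -> W) x :
  (forall u v, f u v = g u v) -> tlift f x = tlift g x.
Proof. by move=> fg; congr tlift; apply/funext => u; apply/funext => v. Qed.

Lemma linear_id (U : lmodType R) : linear (@id U).
Proof. by []. Qed.

End TensorLifts.

Lemma linear_sub (R : nzRingType) (U V : lmodType R) (f : U -> V) : linear f ->
  {morph f : x y / x - y}.
Proof. by move=> lf x y; rewrite -scaleN1r addrC lf scaleN1r addrC. Qed.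

Lemma linear_big (R : nzRingType) (U V : lmodType R) (f : U -> V) I (s : seq I) F :
  linear f -> f (\sum_(i <- s) F i) = \sum_(i <- s) f (F i).
Proof.
move=> lf; elim/big_rec2: _ => [|i y1 y2 _ <-].
  by rewrite -(subrr 0) linear_sub// subrr.
by rewrite -[F i in LHS]scale1r lf scale1r.
Qed.

(** * Multipliers and injectivity of the canonical embedding *)

Section MultiplierEmbedding.
Variables (C : numClosedFieldType) (A : starAlgType C).

Lemma lmul_emb (a x : A) : lmul (emb a) x = a ** x.
Proof. by []. Qed.

Lemma rmul_emb (a x : A) : rmul (emb a) x = x ** a.
Proof. by []. Qed.

Lemma lmul_smul (m n : mult A) x : lmul (m ** n) x = lmul m (lmul n x).
Proof. by []. Qed.

Lemma rmul_smul (m n : mult A) x : rmul (m ** n) x = rmul n (rmul m x).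
Proof. by []. Qed.

Lemma lmul_star (m : mult A) x : lmul (star m) x = star (rmul m (star x)).
Proof. by []. Qed.

Lemma rmul_star (m : mult A) x : rmul (star m) x = star (lmul m (star x)).
Proof. by []. Qed.

Lemma emb_smul (a b : A) : emb (a ** b) = emb a ** emb b.
Proof.
by apply: Defs.multE => x;
  rewrite ?(lmul_smul, rmul_smul) ?(lmul_emb, rmul_emb) smulA.
Qed.

Lemma emb_star (a : A) : emb (star a) = star (emb a).
Proof.
apply: Defs.multE => x; rewrite ?(lmul_star, rmul_star) ?(lmul_emb, rmul_emb);
  by rewrite starM starK.
Qed.

Lemma emb_lmul (m : mult A) (a : A) : emb (lmul m a) = m ** emb a.
Proof.
apply: Defs.multE => x; rewrite ?(lmul_smul, rmul_smul) ?(lmul_emb, rmul_emb).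
- by rewrite lmulM.
- by rewrite rmul_lmul.
Qed.

Lemma emb_rmul (m : mult A) (a : A) : emb (rmul m a) = emb a ** m.
Proof.
apply: Defs.multE => x; rewrite ?(lmul_smul, rmul_smul) ?(lmul_emb, rmul_emb).
- by rewrite rmul_lmul.
- by rewrite rmulM.
Qed.

Lemma emb_inj : nondegenerate_product A -> injective (@emb C A).
Proof.
move=> [nd _] a b ab; apply/eqP; rewrite -subr_eq0; apply/eqP/nd => y.
by rewrite (linear_sub (smul_linl y)) -!lmul_emb ab subrr.
Qed.

End MultiplierEmbedding.

Lemma tensor_smulE (C : numClosedFieldType) (A B : starAlgType C) (x : tensor A B)
    (a : A) (b : B) :
  x ** tens a b = tmap (fun u => u ** a) (fun v => v ** b) x.
Proof.
move: x; apply: tensor_ext.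
- exact: (@smul_linl _ (tensor A B)).
- by apply: tmap_linear; exact: smul_linl.
- by move=> u v; rewrite tmapE; [exact: tensor_mulE|exact: smul_linl..].
Qed.

(** The legs are treated in turn. Right slices of x(1 (x) b) are killed by every [a], so x(1 (x) b)
    = 0; then left slices of [x] are killed by every [b]. *)
Lemma tensor_nondegenerate (C : numClosedFieldType) (A B : starAlgType C)
    (x : tensor A B) : nondegenerate_product A -> nondegenerate_product B ->
  (forall y, x ** y = 0) -> x = 0.
Proof.
move=> [ndA _] [ndB _] x0.
have xb0 b : tmap id (fun v => v ** b) x = 0.
  apply: right_slices_separate => g lg; apply: ndA => a.
  have bg := slice_bilin A lg.
  have lb := smul_linl b.
  have bgb := bilin_pre bg (@linear_id _ _) lb.
  rewrite tlift_tmap// (linear_tlift _ bgb (smul_linl a)).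
  transitivity (tlift (fun u v => g v *: u) (x ** tens a b)); last first.
    by rewrite x0; exact/linear_map0/tlift_linear.
  rewrite tensor_smulE tlift_tmap//; last exact: smul_linl.
  apply: eq_tlift => u v.
  have := smul_linl a (g (v ** b)) u 0.
  by rewrite addr0 (linear_map0 (smul_linl a)) addr0.
apply: functional_pairs_separate => f lf g lg.
have bf : bilin (fun (u : A) (v : B) => (f u : C) *: v).
  split=> [v|u] c y z; first by rewrite lf scalerDl -scalerA.
  by rewrite scalerDr !scalerA mulrC.
have -> : tlift (fun u v => f u * g v : C^o) x =
    g (tlift (fun u v => (f u : C) *: v) x).
  rewrite linear_tlift//; apply: eq_tlift => u v.
  by have := lg (f u) v 0; rewrite addr0 (linear_map0 lg) addr0.
suff -> : tlift (fun u v => (f u : C) *: v) x = 0 by exact: linear_map0.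
apply: ndB => b; rewrite (linear_tlift _ bf (smul_linl b)).
transitivity (tlift (fun u v => (f u : C) *: v)
  (tmap id (fun v => v ** b) x)); last first.
  by rewrite xb0; exact/linear_map0/tlift_linear.
rewrite tlift_tmap//; last exact: smul_linl.
apply: eq_tlift => u v.
by have := smul_linl b (f u) v 0; rewrite addr0 (linear_map0 (smul_linl b)) addr0.
Qed.

(** This recovers a tensor from the multiplier it defines, the form in which Delta(a)(1 (x) b) and
    (a (x) 1)Delta(b) are given. *)
Lemma emb_tensor_inj (C : numClosedFieldType) (A B : starAlgType C) :
  nondegenerate_product A -> nondegenerate_product B ->
  injective (@emb C (tensor A B)).
Proof.
move=> ndA ndB x y xy; apply/eqP; rewrite -subr_eq0; apply/eqP.
apply: tensor_nondegenerate => // z.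
by rewrite (linear_sub (smul_linl z)) -!lmul_emb xy subrr.
Qed.

(** * Hilbert spaces *)

Section HilbertSpaces.
Variable C : numClosedFieldType.
Implicit Types H K : hilbertType C.

Lemma dotBl H (x y z : H) : dot (x - y) z = dot x z - dot y z.
Proof. exact: (linear_sub (@dot_scalar C H z)). Qed.

Lemma dot0l H (z : H) : dot 0 z = 0.
Proof. by rewrite -(subrr 0) dotBl subrr. Qed.

Lemma dotDl H (x y z : H) : dot (x + y) z = dot x z + dot y z.
Proof. by rewrite -[x]scale1r dot_scalar mul1r scale1r. Qed.

Lemma dotZl H c (x z : H) : dot (c *: x) z = c * dot x z.
Proof. by rewrite -[c *: x]addr0 dot_scalar dot0l addr0. Qed.

Lemma dotBr H (x y z : H) : dot z (x - y) = dot z x - dot z y.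
Proof. by rewrite dot_conj dotBl rmorphB /= -!dot_conj. Qed.

Lemma dotZr H c (x z : H) : dot z (c *: x) = c^* * dot z x.
Proof. by rewrite dot_conj dotZl rmorphM /= -dot_conj. Qed.

Lemma dotDr H (x y z : H) : dot z (x + y) = dot z x + dot z y.
Proof. by rewrite dot_conj dotDl rmorphD /= -!dot_conj. Qed.

Lemma cauchy_schwarz H (x y : H) : `|dot x y| <= `|x| * `|y|.
Proof.
have [->|y0] := eqVneq y 0.
  by rewrite dot_conj dot0l conjC0 !normr0 mulr0.
have ny : 0 < `|y| ^+ 2 by rewrite exprn_gt0// normr_gt0.
rewrite -(@ler_pXn2r _ 2)// ?nnegrE ?mulr_ge0// exprMn -subr_ge0.
rewrite -(pmulr_rge0 _ ny); set d := dot x y.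
(* The vector on the right is |y|^2 times the component of [x] orthogonal to [y], scaled to avoid a
   division. *)
suff -> : `|y| ^+ 2 * (`|x| ^+ 2 * `|y| ^+ 2 - `|d| ^+ 2) =
    `| `|y| ^+ 2 *: x - d *: y | ^+ 2 by rewrite exprn_ge0.
rewrite -[RHS]dot_norm dotBl !dotBr !dotZl !dotZr !dot_norm -/d.
have -> : dot y x = d^* by rewrite dot_conj.
have -> : (`|y| ^+ 2)^* = `|y| ^+ 2 by rewrite conj_Creal// realE exprn_ge0.
rewrite normCK; set n := _ ^+ 2; set m := _ ^+ 2; ring.
Qed.

Lemma dot_eq0 H (x : H) : (forall y, dot x y = 0) -> x = 0.
Proof.
by move=> /(_ x); rewrite dot_norm => /eqP; rewrite sqrf_eq0 normr_eq0 => /eqP.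
Qed.

Lemma dense_ball H (X : set H) h (e : C) : dense X -> 0 < e ->
  exists2 x, X x & `|h - x| < e.
Proof.
move=> dX e0; have [|x [+ Xx]] := dX (ball h e) _ (ball_open _ _).
  by exists h; exact: ballxx.
by rewrite -ball_normE => hx; exists x.
Qed.

Lemma bop_bound H K (T : bop H K) :
  exists2 c : C, 0 < c & forall x, `|T x| <= c * `|x|.
Proof.
pose F : {linear H -> K} :=
  HB.pack (T : H -> K) (GRing.isLinear.Build _ _ _ _ (T : H -> K) (bop_linear T)).
have : bounded_near F (nbhs 0).
  by apply/linear_bounded_continuous; exact: bop_continuous.
move=> /linear_boundedP [M [Mr hM]].
exists (`|M| + 1); first by rewrite ltr_wpDl.
by apply: hM; rewrite (le_lt_trans (real_ler_norm Mr))// ltrDl.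
Qed.

Lemma bounded_linear_bop H K (f : H -> K) (c : C) : linear f ->
  (forall x, `|f x| <= c * `|x|) -> exists T : bop H K, T =1 f :> (H -> K).
Proof.
move=> lf fc.
pose F : {linear H -> K} := HB.pack f (GRing.isLinear.Build _ _ _ _ f lf).
suff cF : continuous F.
  have fP : f \in @bop_pred C H K by apply/asboolP.
  by exists (Bop fP).
apply/linear_bounded_continuous/linear_boundedP.
(* The order of [C] is partial and [c] may fail to be real; a nonzero vector forces it to be, and on
   the zero space the bound 0 serves. *)
have [[x x0]|xs0] := pselect (exists x : H, x != 0).
  have cr : c \is Num.real.
    have nx : `|x| != 0 by rewrite normr_eq0.
    rewrite -[c](mulfK nx); apply: realM; last by rewrite realV normr_real.
    exact/ger0_real/(le_trans (normr_ge0 _) (fc x)).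
  exists c; split=> // r cr' x1.
  by rewrite (le_trans (fc x1))// ler_wpM2r// ltW.
exists 0; split=> // r r0 x.
have -> : x = 0 by apply: contrapT => /eqP x0; apply: xs0; exists x.
by rewrite linear0 !normr0 mulr0.
Qed.

(** The closure [G] of the set of pairs (i x, f x) is shown to be the graph of an operator: the
    bound passes to [G] and makes it single-valued, while density of the range of [i] and
    completeness of [K] make it total. *)
Lemma bop_extension (X : lmodType C) H K (i : X -> H) (f : X -> K) (c : C) :
  linear i -> linear f -> dense (range i) -> 0 <= c ->
  (forall x, `|f x| <= c * `|i x|) ->
  exists T : bop H K, forall x, T (i x) = f x.
Proof.
move=> li lf di c0 fc.
have c1 : 0 < 1 + c by rewrite ltr_wpDr.
pose G h k := forall e : C, 0 < e -> exists x, `|h - i x| < e /\ `|k - f x| < e.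
have fB x y : `|f x - f y| <= c * `|i x - i y|.
  by rewrite -(linear_sub lf) -(linear_sub li).
have G_lin a h k h' k' : G h k -> G h' k' -> G (a *: h + h') (a *: k + k').
  move=> hk hk' e e0.
  have a1 : 0 < `|a| + 1 by rewrite ltr_wpDl.
  have d0 : 0 < e / (`|a| + 1) by rewrite divr_gt0.
  have eE : `|a| * (e / (`|a| + 1)) + e / (`|a| + 1) = e.
    by field; rewrite gt_eqF.
  have [x [hx kx]] := hk _ d0; have [x' [hx' kx']] := hk' _ d0.
  have BE (V : lmodType C) (u u' v v' : V) :
      a *: u + u' - (a *: v + v') = a *: (u - v) + (u' - v').
    by rewrite opprD addrACA scalerBr.
  exists (a *: x + x'); rewrite li lf -eE !BE.
  by split; rewrite (le_lt_trans (ler_normD _ _))// ler_ltD// normrZ ler_wpM2l// ltW.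
have G_bound h k : G h k -> `|k| <= c * `|h|.
  move=> hk; apply/ler_addgt0Pr => e e0.
  have d0 : 0 < e / (1 + c) by rewrite divr_gt0.
  have [x [hx kx]] := hk _ d0.
  have -> : c * `|h| + e = e / (1 + c) + c * (`|h| + e / (1 + c)).
    by field; rewrite gt_eqF.
  rewrite -[k](subrK (f x)) (le_trans (ler_normD _ _))// lerD//; first exact: ltW.
  rewrite (le_trans (fc x))// ler_wpM2l// -[i x](subKr h).
  by rewrite (le_trans (ler_normB _ _))// lerD2l ltW.
have G_uniq h k k' : G h k -> G h k' -> k = k'.
  move=> hk hk'; apply/eqP; rewrite -subr_eq0 -normr_le0.
  have := G_bound _ _ (G_lin (-1) _ _ _ _ hk' hk).
  by rewrite !scaleN1r addNr normr0 mulr0 addrC.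
have G_ex h : exists k, G h k.
  pose B (e : C) := [set k | exists2 x, k = f x & `|h - i x| < e].
  pose F := filter_from [set e : C | 0 < e] B.
  have hB e : 0 < e -> B e !=set0.
    by move=> e0; have [_ [x _ <-] hx] := dense_ball h di e0; exists (f x), x.
  have FF : ProperFilter F.
    apply: filter_from_proper => //; apply: filter_from_filter.
      by exists 1 => /=.
    (* A positive element below both [d] and [e], written without comparing them. *)
    move=> d e d0 e0; exists (d * e / (d + e)).
      by rewrite /= divr_gt0 ?mulr_gt0 ?addr_gt0.
    move=> _ [x -> hx]; split; exists x => //; rewrite (lt_le_trans hx)//.
      by rewrite ler_pdivrMr ?addr_gt0// ler_pM2l// lerDr ltW.
    by rewrite ler_pdivrMr ?addr_gt0// mulrC ler_pM2l// lerDl ltW.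
  have : cvg F.
    apply/cauchy_cvgP/cauchy_exP => e e0.
    (* Two points this close to [h] are within e/(1 + c) of each other, so their images are within c
       e/(1 + c), which is less than [e] even when [c] is 0. *)
    have d0 : 0 < e / (2 * (1 + c)) by rewrite divr_gt0// mulr_gt0.
    have [_ [x _ <-] hx] := dense_ball h di d0.
    exists (f x), (e / (2 * (1 + c))) => // _ [y -> hy].
    rewrite -ball_normE /=; apply: (le_lt_trans (fB x y)).
    have : `|i x - i y| <= e / (1 + c).
      rewrite -(subrKA h) (le_trans (ler_normD _ _))//.
      have -> : e / (1 + c) = e / (2 * (1 + c)) + e / (2 * (1 + c)).
        by field; rewrite gt_eqF.
      by rewrite lerD// ltW// distrC.
    move=> /(ler_wpM2l c0)/le_lt_trans; apply.
    by rewrite mulrCA -ltr_pdivlMl// mulVf ?gt_eqF// ltr_pdivrMr// mul1r ltrDr.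
  move=> Fcvg; exists (lim F) => e e0.
  have Fe : F (ball (lim F) e `&` B e).
    by apply: filterI; [exact/Fcvg/nbhsx_ballx | exists e].
  have [k [kx [x kE hx]]] := filter_ex Fe.
  by exists x; split=> //; move: kx; rewrite -ball_normE kE.
have [T TP] := choice G_ex.
have [|x|S ST] := @bounded_linear_bop H K T c.
- by move=> a x y; apply: G_uniq (TP _) _; exact: G_lin (TP x) (TP y).
- exact: G_bound (TP x).
exists S => x; rewrite ST; apply: G_uniq (TP _) _ => e e0.
by exists x; rewrite !subrr !normr0.
Qed.

End HilbertSpaces.

(** * Completed tensor products and slices of operators *)

Section HilbertTensors.
Variable C : numClosedFieldType.

Lemma denseP (H : hilbertType C) (X : set H) :
  (forall h (e : C), 0 < e -> exists2 x, X x & `|h - x| < e) -> dense X.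
Proof.
move=> hX O [h Oh] oO; have /nbhs_ballP[e /= e0 eO] := open_nbhs_nbhs (conj oO Oh).
by have [x Xx hx] := hX h e e0; exists x; split=> //; apply: eO; rewrite -ball_normE.
Qed.

Lemma norm_le_dot (H : hilbertType C) (x : H) (c : C) : 0 <= c ->
  (forall y, `|dot x y| <= c * `|y|) -> `|x| <= c.
Proof.
move=> c0 h; have [->|x0] := eqVneq x 0; first by rewrite normr0.
have nx : 0 < `|x| by rewrite normr_gt0.
have := h x; rewrite dot_norm ger0_norm ?exprn_ge0//.
by rewrite expr2 ler_pM2r.
Qed.

Lemma dot_sum (H : hilbertType C) I (s : seq I) (F : I -> H) y :
  dot (\sum_(i <- s) F i) y = \sum_(i <- s) dot (F i) y.
Proof.
elim/big_rec2: _ => [|i y1 y2 _ <-]; first exact: dot0l.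
exact: dotDl.
Qed.

Variables (H : hilbertType C) (K : hilbert_tensor H H).

Lemma ht_bilin : bilin (fun x y : H => ht_map K (tens x y)).
Proof. exact: bilin_comp (tens_bilin _ _) (@ht_linear _ _ _ K). Qed.

Lemma ht_norm (x y : H) : `|ht_map K (tens x y)| = `|x| * `|y|.
Proof.
apply: (@pexpIrn _ 2) => //; rewrite ?nnegrE ?mulr_ge0//.
by rewrite -dot_norm ht_dot !dot_norm exprMn.
Qed.

Lemma right_slice_bilin (eta : H) : bilin (fun a b : H => dot b eta *: a).
Proof.
split=> [v|u] c x y; first by rewrite scalerDr !scalerA mulrC.
by rewrite dot_scalar scalerDl -scalerA.
Qed.

Lemma ht_dot_slice t (z eta : H) :
  dot (ht_map K t) (ht_map K (tens z eta)) =
    dot (tlift (fun a b => dot b eta *: a) t) z.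
Proof.
have bs := right_slice_bilin eta.
move: t; apply: (@tensor_ext C H H C^o) => [c x y|c x y|u v].
- by rewrite (@ht_linear _ _ _ K) dot_scalar.
- by rewrite tlift_linear// dot_scalar.
- by rewrite tliftE// ht_dot dotZl mulrC.
Qed.

(** [L] is the adjoint of [z |-> z (x) eta]: the algebraic slice sends a (x) b to <b, eta> a and is
    bounded by the norm of [eta], so it extends to [K]. *)
Lemma exists_right_slice (eta : H) : exists L : bop K H,
  forall k z, dot (L k) z = dot k (ht_map K (tens z eta)).
Proof.
have bs := right_slice_bilin eta.
have [||||t|L LE] := @bop_extension C _ _ _ (ht_map K)
    (tlift (fun a b : H => dot b eta *: a)) `|eta|.
- exact: ht_linear.
- exact: tlift_linear.
- exact: ht_dense.
- exact: normr_ge0.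
- set w := tlift _ t; apply: norm_le_dot; first by rewrite mulr_ge0.
  move=> y; rewrite -ht_dot_slice (le_trans (cauchy_schwarz _ _))//.
  have -> : `|eta| * `|ht_map K t| * `|y| = `|ht_map K t| * (`|y| * `|eta|) by ring.
  by rewrite ht_norm.
exists L => k z; apply/eqP; rewrite -subr_eq0 -normr_le0; apply/ler_addgt0Pr => e e0.
have [c c0 Lc] := bop_bound L.
pose m := c * `|z| + `|z| * `|eta| + 1.
have m0 : 0 < m by rewrite ltr_wpDl// addr_ge0// mulr_ge0// ltW.
have em : 0 < e / m by rewrite divr_gt0.
have [_ [t _ <-] kt] := dense_ball k (@ht_dense _ _ _ K) em.
have -> : dot (L k) z - dot k (ht_map K (tens z eta)) =
    dot (L (k - ht_map K t)) z - dot (k - ht_map K t) (ht_map K (tens z eta)).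
  rewrite (linear_sub (bop_linear L)) LE !dotBl ht_dot_slice.
  by rewrite opprB addrA subrK.
rewrite add0r (le_trans (ler_normB _ _))//.
have h1 := le_trans (cauchy_schwarz (L (k - ht_map K t)) z)
  (ler_wpM2r (normr_ge0 z) (Lc _)).
have h2 := cauchy_schwarz (k - ht_map K t) (ht_map K (tens z eta)).
rewrite (le_trans (lerD h1 h2))// ht_norm.
have -> : c * `|k - ht_map K t| * `|z| + `|k - ht_map K t| * (`|z| * `|eta|) =
  `|k - ht_map K t| * (c * `|z| + `|z| * `|eta|) by ring.
rewrite (le_trans (ler_wpM2r _ (ltW kt)))//.
  by rewrite addr_ge0// mulr_ge0// ltW.
rewrite -mulrA ler_piMr//; first exact: ltW.
by rewrite mulrC ler_pdivrMr// mul1r lerDl.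
Qed.

(** Composing [z |-> z (x) xi], [V] and the right slice by [eta] yields the required operator, so
    [xget] does not fall back on 0. *)
Lemma vector_sliceE (V : bop K K) (xi eta z z' : H) :
  dot (vector_slice V xi eta z) z' =
    dot (V (ht_map K (tens z xi))) (ht_map K (tens z' eta)).
Proof.
have [L LE] := exists_right_slice eta.
have [|x|I IE] := @bounded_linear_bop C H K (fun z => ht_map K (tens z xi)) `|xi|.
- exact: ht_bilin.1.
- by rewrite ht_norm mulrC.
have : exists S : bop H H, forall z z' : H,
    dot (S z) z' = dot (V (ht_map K (tens z xi))) (ht_map K (tens z' eta)).
  by exists (bop_comp L (bop_comp V I)) => y y' /=; rewrite LE IE.
by move=> /(@xgetPex _ 0); apply.
Qed.

(** One constant serves all [xi] and [eta]; an estimate on functionals in dual norm will thus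
    control their slices of [V] uniformly. *)
Lemma vector_slice_bound (V : bop K K) : exists2 c : C, 0 < c &
  forall xi eta z, `|vector_slice V xi eta z| <= c * `|xi| * `|eta| * `|z|.
Proof.
have [c c0 Vc] := bop_bound V; exists c => // xi eta z.
apply: norm_le_dot => [|y]; first by rewrite !mulr_ge0// ltW.
rewrite vector_sliceE (le_trans (cauchy_schwarz _ _))// ht_norm.
rewrite (le_trans (ler_wpM2r _ (Vc _)))// ?mulr_ge0// ht_norm.
set u := `|_|; set v := `|_|; set w := `|_|; set v' := `|_|.
suff -> : c * (u * v) * (w * v') = c * v * v' * u * w by [].
ring.
Qed.

Lemma ht_dense_range (X Y : lmodType C) (i : X -> H) (j : Y -> H) :
  linear i -> linear j -> dense (range i) -> dense (range j) ->
  dense (range (fun t => ht_map K (tmap i j t))).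
Proof.
move=> li lj di dj; apply: denseP => k e e0.
have e20 : 0 < e / 2 by rewrite divr_gt0.
have [_ [s _ <-] ks] := dense_ball k (@ht_dense _ _ _ K) e20.
suff [t st] : exists t, `|ht_map K s - ht_map K (tmap i j t)| < e / 2.
  exists (ht_map K (tmap i j t)); first by exists t.
  by rewrite -(subrKA (ht_map K s)) (le_lt_trans (ler_normD _ _))// [e]splitr ltrD.
have lht := @ht_linear _ _ _ K.
have lt := tmap_linear li lj.
move: (e / 2) e20 => {e e0 ks} e.
elim/tensor_ind: s e => [|s s' IH IH'|u v] e e0.
- by exists 0; rewrite (linear_map0 lt) subrr normr0.
- have e20 : 0 < e / 2 by rewrite divr_gt0.
  have [t ht] := IH _ e20; have [t' ht'] := IH' _ e20.
  exists (1 *: t + t'); rewrite lt lht -[s]scale1r lht !scale1r opprD addrACA.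
  by rewrite (le_lt_trans (ler_normD _ _))// [e]splitr ltrD.
have v1 : 0 < `|v| + 1 by rewrite ltr_wpDl.
have d0 : 0 < e / (2 * (`|v| + 1)) by rewrite divr_gt0// mulr_gt0.
have [_ [x _ <-] ux] := dense_ball u di d0.
(* [y] is chosen after [x], since its tolerance depends on the norm of [i x]. *)
have i1 : 0 < `|i x| + 1 by rewrite ltr_wpDl.
have d0' : 0 < e / (2 * (`|i x| + 1)) by rewrite divr_gt0// mulr_gt0.
have [_ [y _ <-] vy] := dense_ball v dj d0'.
exists (tens x y); rewrite tmapE//.
have -> : ht_map K (tens u v) - ht_map K (tens (i x) (j y)) =
    ht_map K (tens (u - i x) v) + ht_map K (tens (i x) (v - j y)).
  rewrite (linear_sub (ht_bilin.1 v)) (linear_sub (ht_bilin.2 (i x))).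
  by rewrite addrA subrK.
rewrite (le_lt_trans (ler_normD _ _))// !ht_norm [e]splitr.
have half (a d : C) : 0 <= a -> 0 <= d -> d < e / (2 * (a + 1)) -> d * a < e / 2.
  move=> a0 d00 da; have a1 : 0 < a + 1 by rewrite ltr_wpDl.
  have -> : e / 2 = e / (2 * (a + 1)) * (a + 1) by field; rewrite gt_eqF.
  apply: (@le_lt_trans _ _ (d * (a + 1))); last by rewrite ltr_pM2r.
  by rewrite ler_wpM2l// lerDl.
apply: ltrD; first exact: half.
by rewrite mulrC; exact: half.
Qed.

End HilbertTensors.

(** * The regular representation *)

Section DenseVanishing.
Variable C : numClosedFieldType.

(** Stated for additive [f] so as to cover antilinear maps, such as an inner product in its second
    argument. *)
Lemma dense_vanishing (H : hilbertType C) (W : normedModType C) (X : set H)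
    (f : H -> W) (c : C) : dense X -> {morph f : x y / x - y} ->
  (forall x, `|f x| <= c * `|x|) -> (forall x, X x -> f x = 0) ->
  forall x, f x = 0.
Proof.
move=> dX fB fc f0 x; have [->|x0] := eqVneq x 0.
  by rewrite -(subrr 0) fB subrr.
have c0 : 0 <= c.
  have nx : 0 < `|x| by rewrite normr_gt0.
  by rewrite -(pmulr_lge0 _ nx) (le_trans _ (fc x)).
apply/eqP; rewrite -normr_le0; apply/ler_addgt0Pr => e e0.
have c1 : 0 < c + 1 by rewrite ltr_wpDl.
have d0 : 0 < e / (c + 1) by rewrite divr_gt0.
have [y Xy xy] := dense_ball x dX d0.
rewrite add0r -[f x]subr0 -(f0 y Xy) -fB (le_trans (fc _))//.
rewrite (le_trans (ler_wpM2l c0 (ltW xy)))//.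
by rewrite mulrCA ger_pMr// ler_pdivrMr// mul1r lerDl.
Qed.

Lemma dense_bop_eq (H K : hilbertType C) (X : set H) (S T : bop H K) :
  dense X -> (forall x, X x -> S x = T x) -> S =1 T :> (H -> K).
Proof.
move=> dX ST x; apply/eqP; rewrite -subr_eq0; apply/eqP.
have [c c0 Sc] := bop_bound S; have [d d0 Td] := bop_bound T.
apply: (dense_vanishing (f := fun x => S x - T x) (c := c + d) dX).
- move=> y z; rewrite (linear_sub (bop_linear S)) (linear_sub (bop_linear T)).
  by rewrite !opprB [T z - S z]addrC [RHS]addrACA [- T y + _]addrC.
- by move=> y; rewrite (le_trans (ler_normB _ _))// mulrDl lerD.
- by move=> y Xy; rewrite ST// subrr.
Qed.

Lemma tensor_sesqui_eq (U V : lmodType C) (K K' : hilbertType C)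
    (f : tensor U V -> K) (g : tensor U V -> K') : linear f -> linear g ->
  (forall x x' y y', dot (f (tens x x')) (f (tens y y')) =
                     dot (g (tens x x')) (g (tens y y'))) ->
  forall t s, dot (f t) (f s) = dot (g t) (g s).
Proof.
move=> lf lg fg t s.
have fD t1 t2 : f (t1 + t2) = f t1 + f t2.
  by rewrite -[t1]scale1r lf !scale1r.
have gD t1 t2 : g (t1 + t2) = g t1 + g t2.
  by rewrite -[t1]scale1r lg !scale1r.
have dot0r (L : hilbertType C) (x : L) : dot x 0 = 0.
  by rewrite dot_conj dot0l conjC0.
elim/tensor_ind: s => [|s s' IH IH'|y y'].
- by rewrite (linear_map0 lf) (linear_map0 lg) !dot0r.
- by rewrite fD gD !dotDr IH IH'.
elim/tensor_ind: t => [|t t' IH IH'|x x'] //.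
- by rewrite (linear_map0 lf) (linear_map0 lg) !dot0l.
- by rewrite fD gD !dotDl IH IH'.
Qed.

End DenseVanishing.

(** * The GNS space and the isometry of the regular representation *)

Section GNSRepresentation.
Variables (C : numClosedFieldType) (A : starAlgType C).
Variable psi : {scalar A}.
Hypothesis ndA : nondegenerate_product A.

Lemma fun_iota_bilin : bilin (fun a b : A => psi a *: b).
Proof.
split=> [v|u] c x y; first by rewrite linearP scalerDl -scalerA.
by rewrite scalerDr !scalerA mulrC.
Qed.

Lemma fun_iota_linear : linear (fun_iota psi).
Proof. exact: tlift_linear fun_iota_bilin. Qed.

Lemma fun_iota_tmap (h : A -> A) w : linear h ->
  fun_iota psi (tmap id h w) = h (fun_iota psi w).
Proof.
move=> lh; rewrite /fun_iota tlift_tmap//; last exact: fun_iota_bilin.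
rewrite (linear_tlift _ fun_iota_bilin lh); apply: eq_tlift => u v.
by have := lh (psi u) v 0; rewrite addr0 (linear_map0 lh) addr0.
Qed.

Lemma tmap_comp (U V U' V' U'' V'' : lmodType C) (f : U' -> U'') (g : V' -> V'')
    (f' : U -> U') (g' : V -> V') x :
  linear f -> linear g -> linear f' -> linear g' ->
  tmap f g (tmap f' g' x) = tmap (f \o f') (g \o g') x.
Proof. by move=> lf lg lf' lg'; rewrite [LHS]tlift_tmap//; exact: tmap_bilin. Qed.

Lemma star_mtens (a b : mult A) : star (mtens a b) = mtens (star a) (star b).
Proof.
apply: Defs.multE => x; rewrite ?lmul_star ?rmul_star.
- rewrite -[RHS]/(tmap (lmul (star a)) (lmul (star b)) x).
  rewrite -[X in star X]/(tmap (rmul a) (rmul b) (star x)).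
  have lr := tmap_linear (rmul_linear a) (rmul_linear b).
  have ll := tmap_linear (lmul_linear (star a)) (lmul_linear (star b)).
  elim/tensor_ind: x => [|x y IH IH'|u v].
  + by rewrite star0 (linear_map0 lr) (linear_map0 ll) star0.
  + rewrite starD -[star x]scale1r lr scale1r starD IH IH'.
    by rewrite -[x in RHS]scale1r ll scale1r.
  + rewrite [star (tens u v)]tensor_starE !tmapE;
      [|exact: lmul_linear..|exact: rmul_linear|exact: rmul_linear].
    exact: tensor_starE.
- rewrite -[RHS]/(tmap (rmul (star a)) (rmul (star b)) x).
  rewrite -[X in star X]/(tmap (lmul a) (lmul b) (star x)).
  have lr := tmap_linear (lmul_linear a) (lmul_linear b).
  have ll := tmap_linear (rmul_linear (star a)) (rmul_linear (star b)).
  elim/tensor_ind: x => [|x y IH IH'|u v].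
  + by rewrite star0 (linear_map0 lr) (linear_map0 ll) star0.
  + rewrite starD -[star x]scale1r lr scale1r starD IH IH'.
    by rewrite -[x in RHS]scale1r ll scale1r.
  + rewrite [star (tens u v)]tensor_starE !tmapE;
      [|exact: rmul_linear..|exact: lmul_linear|exact: lmul_linear].
    exact: tensor_starE.
Qed.

Lemma star_mult1 : star (@mult1 C A) = mult1.
Proof. by apply: Defs.multE => x; rewrite ?lmul_star ?rmul_star -[RHS]starK. Qed.

Variables (H : gns_completion psi) (K : hilbert_tensor H H).

Definition gns_tensor (t : tensor A A) : K :=
  ht_map K (tmap (Lambda H) (Lambda H) t).

Lemma gns_tensor_linear : linear gns_tensor.
Proof.
move=> c x y; rewrite /gns_tensor tmap_linear; [|exact: Lambda_linear..].
exact: ht_linear.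
Qed.

Lemma gns_tensorE x x' : gns_tensor (tens x x') =
  ht_map K (tens (Lambda H x) (Lambda H x')).
Proof. by rewrite /gns_tensor tmapE//; exact: Lambda_linear. Qed.

Lemma gns_tensor_dense : dense (range gns_tensor).
Proof.
by apply: ht_dense_range;
  [exact: Lambda_linear..|exact: Lambda_dense|exact: Lambda_dense].
Qed.

Lemma gns_tensor_dot (u v : tensor A A) :
  dot (gns_tensor u) (gns_tensor v) = psi (fun_iota psi (star v ** u)).
Proof.
have lG := gns_tensor_linear.
have GD t s : gns_tensor (t + s) = gns_tensor t + gns_tensor s.
  by rewrite -[t]scale1r lG !scale1r.
have lI : linear (fun t => psi (fun_iota psi t) : C^o).
  by move=> c x y; rewrite fun_iota_linear linearP.
have ID t s : psi (fun_iota psi (t + s)) =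
    psi (fun_iota psi t) + psi (fun_iota psi s).
  by have := lI 1 t s; rewrite !scale1r.
have I0 : psi (fun_iota psi 0) = 0 by exact: linear_map0 lI.
elim/tensor_ind: v => [|v v' IH IH'|y y'].
- by rewrite (linear_map0 lG) dot_conj dot0l conjC0 star0 [0 ** _]tensor_mul0l I0.
- by rewrite GD dotDr starD [(_ + _) ** u]tensor_mulDl ID IH IH'.
elim/tensor_ind: u => [|u u' IH IH'|x x'].
- by rewrite (linear_map0 lG) dot0l [_ ** 0]tensor_mul0r I0.
- by rewrite GD dotDl [_ ** (u + u')]tensor_mulDr ID IH IH'.
rewrite !gns_tensorE ht_dot !Lambda_dot [star (tens _ _)]tensor_starE.
rewrite [tens _ _ ** _]tensor_mulE.
by rewrite /fun_iota tliftE ?linearZ//; exact: fun_iota_bilin.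
Qed.

Variable Delta : A -> mult (tensor A A).
Hypothesis hom_Delta : star_hom Delta.
Hypothesis hpsi : right_integral Delta psi.

(** Injectivity of [emb] turns right invariance, an identity between multipliers, into one between
    elements of [A]. *)
Lemma right_integralE a b w : emb w = Delta a ** mtens mult1 (emb b) ->
  fun_iota psi w = psi a *: b.
Proof.
move=> wE; have [[w0 w0E w0I] _] := hpsi.2 a b.
have -> : w = w0 by apply: (emb_tensor_inj ndA ndA); rewrite wE.
by apply: (emb_inj ndA); rewrite w0I -emb_lmul.
Qed.

(** As [Delta] is a star-homomorphism, [star v ** u] is (1 (x) star y') Delta(star y ** x) (1 (x)
    x'), and right invariance slices it to the scalar psi(star y ** x) times [star y' ** x']. *)
Lemma Delta_dot x x' y y' u v :
  emb u = Delta x ** mtens mult1 (emb x') ->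
  emb v = Delta y ** mtens mult1 (emb y') ->
  dot (gns_tensor u) (gns_tensor v) =
    dot (gns_tensor (tens x x')) (gns_tensor (tens y y')).
Proof.
move=> uE vE; have [_ DM DS] := hom_Delta.
have [[w wE _] _] := hpsi.2 (star y ** x) x'.
have e : star v ** u = tmap id (smul (star y')) w.
  apply: (emb_tensor_inj ndA ndA).
  rewrite -[tmap _ _ w]/(lmul (mtens mult1 (emb (star y'))) w) emb_lmul wE.
  rewrite emb_smul [emb (star v)]emb_star vE uE starM star_mtens star_mult1.
  rewrite -emb_star.
  by rewrite DM DS !smulA.
rewrite gns_tensor_dot e fun_iota_tmap; last exact: smul_linr.
rewrite (right_integralE wE) !gns_tensorE ht_dot !Lambda_dot.
have -> : star y' ** (psi (star y ** x) *: x') =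
    psi (star y ** x) *: (star y' ** x').
  have := smul_linr (star y') (psi (star y ** x)) x' 0.
  by rewrite addr0 (linear_map0 (smul_linr _)) addr0.
by rewrite linearZ.
Qed.

Variable Tr : tensor A A -> tensor A A.
Hypothesis Tr_linear : linear Tr.
Hypothesis TrE : forall a b, emb (Tr (tens a b)) = Delta a ** mtens mult1 (emb b).

(** By [Delta_dot], [Tr] preserves inner products of GNS vectors and so extends to an isometry of
    [K]; injectivity of [emb] gives this extension the defining property for every admissible
    [u]. *)
Lemma right_regularE x x' u : emb u = Delta x ** mtens mult1 (emb x') ->
  right_regular Delta K (ht_map K (tens (Lambda H x) (Lambda H x'))) = gns_tensor u.
Proof.
have lG := gns_tensor_linear.
have lGT : linear (gns_tensor \o Tr) by move=> c y z; rewrite /= Tr_linear lG.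
have iso : forall t s, dot (gns_tensor (Tr t)) (gns_tensor (Tr s)) =
    dot (gns_tensor t) (gns_tensor s).
  by apply: (tensor_sesqui_eq lGT lG) => x1 x1' y y'; apply: Delta_dot; exact: TrE.
have [||t|V VE] := @bop_extension C _ _ _ gns_tensor (gns_tensor \o Tr) 1 lG lGT.
- exact: gns_tensor_dense.
- exact: ler01.
- rewrite mul1r -(@ler_pXn2r _ 2)// ?nnegrE//= -!dot_norm iso//.
have : exists V : bop K K, forall x x' (u : tensor A A),
    emb u = Delta x ** mtens mult1 (emb x') ->
    V (ht_map K (tens (Lambda H x) (Lambda H x'))) =
      ht_map K (tmap (Lambda H) (Lambda H) u).
  exists V => {x x' u} x x' u uE; rewrite -gns_tensorE VE /=.
  by congr gns_tensor; apply: (emb_tensor_inj ndA ndA); rewrite TrE.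
by move=> /(@xgetPex _ 0); apply.
Qed.

(** Both sides are [psi] of [star y'] times the slice of (star y (x) 1) Delta(x) (1 (x) x'):
    bracketed to the right this product involves [V], bracketed to the left it involves [w]. *)
Lemma regular_slice_dot x y w x' y' :
  emb w = mtens (emb (star y)) mult1 ** Delta x ->
  dot (Lambda H (fun_iota psi w ** x')) (Lambda H y') =
  dot (right_regular Delta K (ht_map K (tens (Lambda H x) (Lambda H x'))))
      (ht_map K (tens (Lambda H y) (Lambda H y'))).
Proof.
move=> wE; set u := Tr (tens x x').
rewrite (right_regularE (u := u)); last exact: TrE.
rewrite -gns_tensorE gns_tensor_dot Lambda_dot [star (tens _ _)]tensor_starE.
have e : tmap (smul (star y)) id u = tmap id (smul^~ x') w.
  apply: (emb_tensor_inj ndA ndA).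
  rewrite -[tmap _ _ u]/(lmul (mtens (emb (star y)) mult1) u) emb_lmul.
  rewrite -[tmap _ _ w]/(rmul (mtens mult1 (emb x')) w) emb_rmul wE TrE.
  by rewrite smulA.
have -> : tens (star y) (star y') ** u =
    tmap id (smul (star y')) (tmap (smul (star y)) id u).
  rewrite tmap_comp//; [|exact: smul_linr..].
  move: (u); apply: tensor_ext.
  - exact: (@smul_linr _ (tensor A A)).
  - by apply: tmap_linear; exact: smul_linr.
  - by move=> a b; rewrite tmapE; [exact: tensor_mulE|exact: smul_linr..].
rewrite e !fun_iota_tmap ?smulA//.
- exact: smul_linl.
- exact: smul_linr.
Qed.

End GNSRepresentation.

(** * Norm and weak closures *)

Section OperatorClosures.
Variables (C : numClosedFieldType) (H : hilbertType C).
Implicit Types X Y : set (bop H H).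

Lemma norm_closure_sub_weak X : norm_closure X `<=` weak_closure X.
Proof.
move=> T TX s e e0; pose m : C := \sum_(p <- s) `|p.1| * `|p.2|.
have m0 : 0 <= m by apply: sumr_ge0 => p _; rewrite mulr_ge0.
have m1 : 0 < m + 1 by rewrite ltr_wpDl.
have [|S XS TS] := TX (e / (m + 1)); first by rewrite divr_gt0.
exists S => // p ps; rewrite (le_lt_trans (cauchy_schwarz _ _))//.
rewrite (le_lt_trans (ler_wpM2r _ (TS _)))//.
have -> : e / (m + 1) * `|p.1| * `|p.2| = e * (`|p.1| * `|p.2|) / (m + 1) by ring.
rewrite ltr_pdivrMr// ltr_pM2l// (@le_lt_trans _ _ m) ?ltrDl//.
by rewrite /m (big_rem p)//= lerDl sumr_ge0// => q _; rewrite mulr_ge0.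
Qed.

Lemma norm_closure_min X Y : Y `<=` norm_closure X ->
  norm_closure Y `<=` norm_closure X.
Proof.
move=> YX T TY e e0; have e20 : 0 < e / 2 by rewrite divr_gt0.
have [S YS TS] := TY _ e20; have [U XU SU] := YX _ YS _ e20.
exists U => // x; rewrite -(subrKA (S x)) (le_trans (ler_normD _ _))//.
by rewrite [e]splitr mulrDl lerD.
Qed.

Lemma sub_norm_closure X : X `<=` norm_closure X.
Proof.
by move=> T XT e e0; exists T => // x; rewrite subrr normr0 mulr_ge0// ltW.
Qed.

End OperatorClosures.

(** * The bounded action of the algebra on its GNS space *)

Section GNSAction.
Variables (C : numClosedFieldType) (A : starAlgType C).
Variable psi : {scalar A}.
Hypothesis ndA : nondegenerate_product A.
Variables (H : gns_completion psi) (K : hilbert_tensor H H).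
Variable Delta : A -> mult (tensor A A).
Hypothesis hom_Delta : star_hom Delta.
Hypothesis hpsi : right_integral Delta psi.
Variable Tr : tensor A A -> tensor A A.
Hypothesis Tr_linear : linear Tr.
Hypothesis TrE : forall a b, emb (Tr (tens a b)) = Delta a ** mtens mult1 (emb b).
Variable Tl : tensor A A -> tensor A A.
Hypothesis Tl_linear : linear Tl.
Hypothesis Tl_bij : bijective Tl.
Hypothesis TlE : forall a b, emb (Tl (tens a b)) = mtens (emb a) mult1 ** Delta b.

Local Notation Lam := (Lambda H).
Local Notation V := (right_regular Delta K).

(* [(psi (x) iota)((y^* (x) 1) Delta(x))], the slice of [V] by the vector
   functional of [Lam x] and [Lam y]. *)
Definition regular_coef (x y : A) : A := fun_iota psi (Tl (tens (star y) x)).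

Lemma regular_coef_dot x y x' y' :
  dot (Lam (regular_coef x y ** x')) (Lam y') =
  dot (V (ht_map K (tens (Lam x) (Lam x')))) (ht_map K (tens (Lam y) (Lam y'))).
Proof. exact: (regular_slice_dot ndA K hom_Delta hpsi Tr_linear TrE). Qed.

(** Pair the vector [k] with itself: its squared norm is a matrix coefficient of the bounded
    operator [V] in which [k] occurs once, and a factor |k| cancels. *)
Lemma regular_coef_bound x y : exists2 c : C, 0 <= c &
  forall x', `|Lam (regular_coef x y ** x')| <= c * `|Lam x'|.
Proof.
have [c c0 Vc] := bop_bound V; exists (c * `|Lam x| * `|Lam y|).
  by rewrite !mulr_ge0// ltW.
move=> x'; set k := Lam (_ ** _).
have [->|k0] := eqVneq k 0; first by rewrite normr0 !mulr_ge0// ltW.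
have nk : 0 < `|k| by rewrite normr_gt0.
rewrite -(ler_pM2r nk) -expr2 -dot_norm {1}/k regular_coef_dot.
have : 0 <= dot (V (ht_map K (tens (Lam x) (Lam x'))))
    (ht_map K (tens (Lam y) (Lam (regular_coef x y ** x')))).
  by rewrite -regular_coef_dot dot_norm exprn_ge0.
move=> /ger0_norm <-; rewrite (le_trans (cauchy_schwarz _ _))// -/k.
rewrite (le_trans (ler_wpM2r _ (Vc _)))// !ht_norm.
by rewrite [X in X <= _](_ : _ = c * `|Lam x| * `|Lam y| * `|Lam x'| * `|k|)//; ring.
Qed.

Lemma regular_coef_span a : exists s : seq (A * A),
  a = \sum_(p <- s) regular_coef p.1 p.2.
Proof.
have [Tl' _ TlK] := Tl_bij; have [[b b0] _] := hpsi.
have lf := fun_iota_linear psi.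
(* [b] is normalised so that [psi] is 1 on the first leg; slicing then returns [a]. *)
have -> : a = fun_iota psi (Tl (Tl' (tens ((psi b)^-1 *: b) a))).
  rewrite TlK /fun_iota tliftE; last exact: fun_iota_bilin.
  by rewrite linearZ /= mulVf// scale1r.
(* The legs are exchanged and one is starred because [regular_coef x y] applies [Tl] to
   [tens (star y) x]. *)
exists [seq (q.2, star q.1) | q <- repr (Tl' (tens ((psi b)^-1 *: b) a))].
rewrite [X in Tl X]tensorE (linear_big _ _ Tl_linear) (linear_big _ _ lf) big_map.
by apply: eq_bigr => p _; rewrite /regular_coef starK.
Qed.

(** The bounds of the finitely many [regular_coef] summing to [a] add up, so left multiplication by
    [a] extends to a bounded operator. *)
Lemma gns_actionE a x : gns_action H a (Lam x) = Lam (a ** x).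
Proof.
have [s aE] := regular_coef_span a.
have lL := @Lambda_linear _ _ _ H.
have sB (t : seq (A * A)) : exists2 c : C, 0 <= c & forall x,
    `|Lam ((\sum_(p <- t) regular_coef p.1 p.2) ** x)| <= c * `|Lam x|.
  elim: t => [|[y z] t [c c0 IH]].
    exists 0 => // y; rewrite big_nil (linear_map0 (smul_linl y)).
    by rewrite (linear_map0 lL) normr0 mul0r.
  have [d d0 hd] := regular_coef_bound y z; exists (d + c); first exact: addr_ge0.
  move=> x'; rewrite big_cons -[regular_coef _ _]scale1r smul_linl lL scale1r.
  by rewrite (le_trans (ler_normD _ _))// mulrDl lerD.
have [c c0 ac] := sB s; rewrite -aE in ac.
have [||T TE] := @bop_extension C _ _ _ Lam (fun x => Lam (a ** x)) c lL _ _ c0 ac.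
- by move=> d y z; rewrite smul_linr lL.
- exact: Lambda_dense.
have : exists T : bop H H, forall x, T (Lam x) = Lam (a ** x) by exists T.
by move=> /(@xgetPex _ 0); apply.
Qed.

Lemma gns_action_linear xi : linear (fun a => gns_action H a xi).
Proof.
move=> c a b; have dL := @Lambda_dense _ _ _ H.
suff : gns_action H (c *: a + b) =1
    (c *: gns_action H a + gns_action H b : bop H H) :> (H -> H) by apply.
apply: (dense_bop_eq dL) => _ [x _ <-].
rewrite -[RHS]/(c *: gns_action H a (Lam x) + gns_action H b (Lam x)).
by rewrite !gns_actionE smul_linl Lambda_linear.
Qed.

(** This exchange of legs brings the action into the form in which [slice] is defined: the vector
    functional of [Lam x] and [Lam y] applied to [vector_slice V xi eta]. *)
Lemma gns_action_coef x y xi eta :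
  dot (gns_action H (regular_coef x y) xi) eta =
  dot (vector_slice V xi eta (Lam x)) (Lam y).
Proof.
have dL := @Lambda_dense _ _ _ H.
have [c c0 Vc] := bop_bound V.
have [d d0 Gd] := bop_bound (gns_action H (regular_coef x y)).
rewrite vector_sliceE; apply/eqP; rewrite -subr_eq0; apply/eqP.
(* [D] vanishes on pairs of GNS vectors; density extends this first in [eta], where [D] is
   antilinear, then in [xi]. *)
pose D (xi eta : H) : C^o := dot (gns_action H (regular_coef x y) xi) eta -
  dot (V (ht_map K (tens (Lam x) xi))) (ht_map K (tens (Lam y) eta)).
have subD (a b a' b' : C) : a - a' - (b - b') = a - b - (a' - b') by ring.
have DB xi' eta' : `|D xi' eta'| <= (d + c * `|Lam x| * `|Lam y|) * `|xi'| * `|eta'|.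
  rewrite (le_trans (ler_normB _ _))// !mulrDl lerD//.
    by rewrite (le_trans (cauchy_schwarz _ _))// ler_wpM2r.
  rewrite (le_trans (cauchy_schwarz _ _))//.
  rewrite (le_trans (ler_wpM2r _ (Vc _)))// !ht_norm.
  by rewrite [X in X <= _](_ : _ = c * `|Lam x| * `|Lam y| * `|xi'| * `|eta'|)//; ring.
have D0 x' eta' : D (Lam x') eta' = 0.
  apply: (dense_vanishing (f := D (Lam x')) dL) (DB (Lam x')) _ _.
    move=> u v; rewrite /D dotBr (linear_sub ((ht_bilin K).2 _)) dotBr.
    exact: subD.
  by move=> _ [y' _ <-]; rewrite /D gns_actionE regular_coef_dot subrr.
apply: (dense_vanishing (f := fun xi => D xi eta) dL) _ _ _ xi.
- move=> u v; rewrite /D (linear_sub (bop_linear _)) dotBl.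
  rewrite (linear_sub ((ht_bilin K).2 _)) (linear_sub (bop_linear _)) dotBl.
  exact: subD.
- by move=> u; rewrite (le_trans (DB u eta))// mulrAC.
- by move=> _ [x' _ <-]; exact: D0.
Qed.

Lemma gns_action_sum s xi eta :
  dot (gns_action H (\sum_(p <- s) regular_coef p.1 p.2) xi) eta =
  \sum_(p <- s) dot (vector_slice V xi eta (Lam p.1)) (Lam p.2).
Proof.
rewrite (linear_big _ _ (gns_action_linear xi)) dot_sum.
by apply: eq_bigr => p _; exact: gns_action_coef.
Qed.

End GNSAction.

(** * Normal functionals *)

Section KernelLemma.
Variables (F : fieldType) (V : lmodType F).

(** Induction on [n]: a vector killed by the first functionals but not by [fs n] tells which
    multiple of [fs n] to subtract from [w], leaving a functional that vanishes on the common kernel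
    of the first [n]. Without such a vector, [fs n] adds no constraint. *)
Lemma kernel_span (fs : nat -> V -> F^o) n (w : V -> F^o) :
  (forall i, (i < n)%N -> linear (fs i)) -> linear w ->
  (forall x, (forall i, (i < n)%N -> fs i x = 0) -> w x = 0) ->
  exists c : nat -> F, forall x, w x = \sum_(i < n) c i * fs i x.
Proof.
elim: n w => [|n IH] w lfs lw hw.
  by exists (fun=> 0) => x; rewrite big_ord0 hw.
have lfs' i : (i < n)%N -> linear (fs i) by move=> ?; apply: lfs; exact: leqW.
have lfn : linear (fs n) by exact: lfs.
have [[x0 [x00 fx0]]|N] := pselect (exists x0,
    (forall i, (i < n)%N -> fs i x0 = 0) /\ fs n x0 != 0).
  pose w' x : F^o := w x - w x0 / fs n x0 * fs n x.
  have lw' : linear w'.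
    move=> c x y; rewrite /w' lw lfn mulrDr opprD addrACA.
    by congr (_ + _); rewrite [RHS]mulrBr [w x0 / _ * _]mulrCA.
  have [x hx|c cE] := IH w' lfs' lw'.
    have := hw (- (fs n x / fs n x0) *: x0 + x).
    rewrite lw => h; rewrite /w' mulrAC -mulrA.
    have -> : w x = w x0 * (fs n x / fs n x0).
      apply/eqP; rewrite -subr_eq0 addrC mulrC -mulNr; apply/eqP/h => i.
      rewrite ltnS leq_eqVlt => /orP[/eqP ->|ni].
        by rewrite lfn [_ *: _]mulNr divfK// addNr.
      by rewrite lfs'// (x00 i ni) (hx i ni) scaler0 addr0.
    by rewrite subrr.
  exists (fun i => if i == n then w x0 / fs n x0 else c i) => x.
  rewrite big_ord_recr /= eqxx; apply/eqP; rewrite -subr_eq; apply/eqP.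
  rewrite -[LHS]/(w' x) cE; apply: eq_bigr => i _.
  by rewrite ltn_eqF.
have [x hx|c cE] := IH w lfs' lw.
  apply: hw => i; rewrite ltnS leq_eqVlt => /orP[/eqP ->|/hx//].
  by apply: contrapT => /eqP fx; apply: N; exists x.
exists (fun i => if i == n then 0 else c i) => x.
rewrite big_ord_recr /= eqxx mul0r addr0 cE; apply: eq_bigr => i _.
by rewrite ltn_eqF.
Qed.

End KernelLemma.

(** * Sigma-weak series and their uniform tails *)

Section SigmaWeak.
Variables (C : numClosedFieldType) (H : hilbertType C).
Hypothesis archC : forall x : C, 0 <= x -> exists n : nat, x < n%:R.

(** If from every index some block exceeded [e], disjoint blocks would push the partial sums beyond
    every integer multiple of [e], against the bound [M] and [archC]. *)
Lemma bounded_sum_tail (u : nat -> C) (M : C) : (forall n, 0 <= u n) ->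
  (forall n, \sum_(k < n) u k <= M) ->
  forall e, 0 < e -> exists N, forall m, \sum_(N <= k < m) u k <= e.
Proof.
move=> u0 uM e e0; apply: contrapT => hN.
have s0 a b : 0 <= \sum_(a <= k < b) u k by exact: sumr_ge0.
have jump N : exists m, e < \sum_(N <= k < m) u k.
  apply: contrapT => hm; apply: hN; exists N => m; apply: contrapT => nm.
  apply: hm; exists m; rewrite real_ltNge; first exact/negP.
    exact/ger0_real/ltW.
  exact/ger0_real.
have grow j : exists N, e *+ j <= \sum_(0 <= k < N) u k.
  elim: j => [|j [N hj]]; first by exists 0; rewrite mulr0n.
  have [m hm] := jump N; exists m.
  have Nm : (N <= m)%N.
    rewrite leqNgt; apply/negP => mN; move: hm.
    by rewrite big_geq ?(ltnW mN)// => /(lt_trans e0); rewrite ltxx.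
  by rewrite (big_cat_nat (n := N))//= mulrSr lerD// ltW.
have M0 : 0 <= M by have := uM 0; rewrite big_ord0.
have [n hn] := archC (divr_ge0 M0 (ltW e0)).
have [N] := grow n; rewrite big_mkord => /le_trans/(_ (uM N)).
rewrite -mulr_natl -ler_pdivlMr// => /(lt_le_trans hn).
by rewrite ltxx.
Qed.

(** A crude bound by the square of the larger number, standing in for Cauchy-Schwarz on
    sequences. *)
Lemma sqr_norm_ge (a b : C) : 0 <= a -> 0 <= b -> a * b <= a ^+ 2 + b ^+ 2.
Proof.
move=> a0 b0; have := @real_leVge _ a b (ger0_real a0) (ger0_real b0).
case/orP => ab.
- by rewrite (le_trans (ler_wpM2r b0 ab))// -expr2 lerDr exprn_ge0.
- by rewrite (le_trans (ler_wpM2l a0 ab))// -expr2 lerDl exprn_ge0.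
Qed.

(** [N] is chosen before [T]: tails are small uniformly over operators of a given bound, which later
    turns sigma-weak series into approximation in the dual norm. *)
Lemma square_summable_dot_tail (xi eta : nat -> H) :
  square_summable xi -> square_summable eta ->
  forall e : C, 0 < e -> exists N, forall (T : bop H H) c, 0 <= c ->
    (forall x, `|T x| <= c * `|x|) ->
    forall m, (N <= m)%N ->
    `|series (fun n => dot (T (xi n)) (eta n)) m -
      series (fun n => dot (T (xi n)) (eta n)) N| <= e * c.
Proof.
move=> [M hM] [M' hM'] e e0; have e20 : 0 < e / 2 by rewrite divr_gt0.
have sq0 (z : nat -> H) n : 0 <= `|z n| ^+ 2 by rewrite exprn_ge0.
have [N1 h1] := bounded_sum_tail (sq0 xi) hM e20.
have [N2 h2] := bounded_sum_tail (sq0 eta) hM' e20.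
have tail (z : nat -> H) N N' m : (N <= N')%N ->
    \sum_(N' <= k < m) `|z k| ^+ 2 <= \sum_(N <= k < m) `|z k| ^+ 2.
  move=> NN; have [mN|Nm] := leqP m N'; first by rewrite big_geq// sumr_ge0.
  by rewrite [leRHS](big_cat_nat (n := N'))//= ?(ltnW Nm)// lerDr sumr_ge0.
exists (maxn N1 N2) => T c c0 Tc m Nm.
rewrite /series /= (big_cat_nat (n := maxn N1 N2) (p := m))//= addrAC subrr add0r.
rewrite (le_trans (ler_norm_sum _ _ _))//.
apply: (@le_trans _ _ (\sum_(maxn N1 N2 <= k < m)
    c * (`|xi k| ^+ 2 + `|eta k| ^+ 2))).
  apply: ler_sum => k _; rewrite (le_trans (cauchy_schwarz _ _))//.
  rewrite (le_trans (ler_wpM2r _ (Tc _)))// -mulrA ler_wpM2l//.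
  exact: sqr_norm_ge.
rewrite -mulr_sumr big_split /= mulrC ler_wpM2r// [e]splitr lerD//.
- by rewrite (le_trans (tail _ _ _ _ (leq_maxl N1 N2))).
- by rewrite (le_trans (tail _ _ _ _ (leq_maxr N1 N2))).
Qed.

(* [C] is isometric to the line of [h] in the complete space [H]. *)
Lemma scalar_series_cvg (h : H) (s : nat -> C^o) : h != 0 ->
  (forall e : C, 0 < e -> exists N, forall m, (N <= m)%N -> `|s m - s N| <= e) ->
  cvg (s @ \oo).
Proof.
move=> h0 hs; have nh : 0 < `|h| by rewrite normr_gt0.
pose v n : H := (s n : C) *: h.
have : cvg (v @ \oo).
  apply/cauchy_cvgP/cauchy_exP => e e0.
  have d0 : 0 < e / 2 / `|h| by rewrite !divr_gt0.
  have [N hN] := hs _ d0; exists (v N); exists N => // m Nm.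
  rewrite -ball_normE /= -scalerBl normrZ distrC.
  rewrite (le_lt_trans (ler_wpM2r _ (hN m Nm)))// divfK ?gt_eqF//.
  by rewrite ltr_pdivrMr// ltr_pMr// ltr1n.
(* The scalar limit is read off the vector limit by pairing with [h]. *)
move=> vcvg; apply/cvg_ex; exists (dot (lim (v @ \oo)) h / `|h| ^+ 2 : C^o).
apply/cvgrPdist_le => e e0.
have d0 : 0 < e * `|h| by rewrite mulr_gt0.
have /cvgrPdist_le /(_ _ d0) := vcvg.
apply: filterS => n hn.
have -> : dot (lim (v @ \oo)) h / `|h| ^+ 2 - s n =
    dot (lim (v @ \oo) - v n) h / `|h| ^+ 2 :> C.
  rewrite dotBl dotZl dot_norm mulrBl mulfK//.
  by rewrite expf_neq0// gt_eqF.
rewrite normrM normfV [ `| `|h| ^+ 2|]ger0_norm ?exprn_ge0//.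
rewrite ler_pdivrMr ?exprn_gt0// (le_trans (cauchy_schwarz _ _))//.
by rewrite expr2 mulrA ler_wpM2r.
Qed.

Definition square_summable_pair (p : (nat -> H) * (nat -> H)) :=
  square_summable p.1 /\ square_summable p.2.

Lemma sigma_weak_cvg p (T : bop H H) : square_summable_pair p ->
  cvg ((series (fun n => dot (T (p.1 n)) (p.2 n)) : nat -> C^o) @ \oo).
Proof.
(* A nonzero vector of [H] serves to embed [C]; if the first sequence is identically 0, so is the
   series. *)
move=> [s1 s2]; have [[k k0]|xi0] := pselect (exists k, p.1 k != 0).
  apply: (scalar_series_cvg k0) => e e0; have [c c0 Tc] := bop_bound T.
  have [N hN] := square_summable_dot_tail s1 s2 (divr_gt0 e0 c0).
  exists N => m Nm; rewrite (le_trans (hN T c (ltW c0) Tc m Nm))//.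
  by rewrite divfK// gt_eqF.
apply: (is_cvg_near_cst (0 : C^o)); apply: nearW => n.
rewrite /series /= big1// => k _; have -> : p.1 k = 0.
  by apply: contrapT => /eqP k0; apply: xi0; exists k.
by rewrite (linear_map0 (bop_linear T)) dot0l.
Qed.

Lemma sigma_weak_linear p : square_summable_pair p ->
  linear (sigma_weak p : bop H H -> C^o).
Proof.
move=> sp c S T; rewrite /sigma_weak.
have -> : (series (fun n => dot ((c *: S + T) (p.1 n)) (p.2 n)) : nat -> C^o) =
    c *: (series (fun n => dot (S (p.1 n)) (p.2 n)) : nat -> C^o) +
    (series (fun n => dot (T (p.1 n)) (p.2 n)) : nat -> C^o).
  apply/funext => n; rewrite !fctE /series /= scaler_sumr -big_split /=.
  by apply: eq_bigr => k _; exact: dot_scalar.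
rewrite limD; [|apply: is_cvgZl_tmp; exact: sigma_weak_cvg|exact: sigma_weak_cvg].
by rewrite limZl_tmp//; exact: sigma_weak_cvg.
Qed.

Lemma sigma_weak_tail p : square_summable_pair p ->
  forall e : C, 0 < e -> exists N, forall (T : bop H H) c, 0 <= c ->
    (forall x, `|T x| <= c * `|x|) ->
    `|sigma_weak p T - \sum_(k < N) dot (T (p.1 k)) (p.2 k)| <= e * c.
Proof.
move=> sp e e0; have [N hN] := square_summable_dot_tail sp.1 sp.2 e0.
exists N => T c c0 Tc; apply/ler_addgt0Pr => d d0.
have /cvgrPdist_le /(_ _ d0) [N' _ hN'] := @sigma_weak_cvg p T sp.
have h1 := hN' (maxn N N') (leq_maxr N N').
have h2 := hN T c c0 Tc (maxn N N') (leq_maxl N N').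
rewrite -(big_mkord xpredT (fun k => dot (T (p.1 k)) (p.2 k))).
rewrite -(subrKA (series (fun n => dot (T (p.1 n)) (p.2 n)) (maxn N N'))).
by rewrite [leRHS]addrC (le_trans (ler_normD _ _))// lerD; [|exact: h1|exact: h2].
Qed.

(** The estimate in [normal] forces [w] to vanish wherever finitely many functionals [sigma_weak]
    do, so [kernel_span] applies and the absolute values disappear. *)
Lemma normal_sum (w : {scalar (bop H H)}) : normal w ->
  exists (n : nat) (c : nat -> C) (p : nat -> (nat -> H) * (nat -> H)),
    (forall i, (i < n)%N -> square_summable_pair (p i)) /\
    forall T, w T = \sum_(i < n) c i * sigma_weak (p i) T.
Proof.
move=> [s hs [M hM]]; pose p i := nth (fun=> 0, fun=> 0) s i.
have [i si||T T0|c cE] := @kernel_span C (bop H H)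
    (fun i => sigma_weak (p i)) (size s) w.
- exact: sigma_weak_linear (hs i si).
- by move=> c S T; rewrite linearP.
- apply/eqP; rewrite -normr_le0 (le_trans (hM T))//.
  rewrite (big_nth (fun=> 0, fun=> 0)) big_mkord big1 ?mulr0// => i _.
  by rewrite T0 ?normr0.
by exists (size s), c, p.
Qed.

End SigmaWeak.

(** * Approximation by vector functionals of a dense subspace *)

Section Approximation.
Variables (C : numClosedFieldType) (H : hilbertType C).
Variables (A : lmodType C) (L : A -> H).
Hypothesis L_linear : linear L.
Hypothesis L_dense : dense (range L).

(* Approximable in the norm of the dual of [B(H)] by vector functionals of the
   dense subspace [range L]. *)
Definition approximable (f : bop H H -> C) := forall e : C, 0 < e ->
  exists s : seq (A * A), forall (T : bop H H) c, 0 <= c ->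
    (forall x, `|T x| <= c * `|x|) ->
    `|f T - \sum_(p <- s) dot (T (L p.1)) (L p.2)| <= e * c.

Lemma approximable0 : approximable (fun=> 0).
Proof.
by move=> e e0; exists [::] => T c c0 _; rewrite big_nil subrr normr0 mulr_ge0// ltW.
Qed.

Lemma approximableD f g : approximable f -> approximable g ->
  approximable (fun T => f T + g T).
Proof.
move=> hf hg e e0; have e20 : 0 < e / 2 by rewrite divr_gt0.
have [s hs] := hf _ e20; have [t ht] := hg _ e20.
exists (s ++ t) => T c c0 Tc; rewrite big_cat /= opprD addrACA.
rewrite (le_trans (ler_normD _ _))// [e]splitr mulrDl lerD//; [exact: hs|exact: ht].
Qed.

Lemma approximableZ a f : approximable f -> approximable (fun T => a * f T).
Proof.
move=> hf e e0; have a1 : 0 < `|a| + 1 by rewrite ltr_wpDl.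
have [|s hs] := hf (e / (`|a| + 1)); first by rewrite divr_gt0.
exists [seq (a *: p.1, p.2) | p <- s] => T c c0 Tc.
have LZ x : L (a *: x) = a *: L x.
  by have := L_linear a x 0; rewrite addr0 (linear_map0 L_linear) addr0.
have TZ x : T (a *: x) = a *: T x.
  by have := bop_linear T a x 0; rewrite addr0 (linear_map0 (bop_linear T)) addr0.
rewrite big_map; under eq_bigr => p _ do rewrite /= LZ TZ dotZl.
rewrite -mulr_sumr -mulrBr normrM (le_trans (ler_wpM2l _ (hs T c c0 Tc)))//.
rewrite mulrA ler_wpM2r// mulrCA ger_pMr// ler_pdivrMr// mul1r.
by rewrite lerDl.
Qed.

Lemma approximable_sum n (f : nat -> bop H H -> C) :
  (forall i, (i < n)%N -> approximable (f i)) ->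
  approximable (fun T => \sum_(i < n) f i T).
Proof.
elim: n => [_|n IH hf].
  by under eq_fun do rewrite big_ord0; exact: approximable0.
under eq_fun do rewrite big_ord_recr /=.
by apply: approximableD; [apply: IH => i ni; apply: hf; exact: leqW|exact: hf].
Qed.

Lemma approximable_lim f : (forall e : C, 0 < e -> exists2 g, approximable g &
    forall (T : bop H H) c, 0 <= c -> (forall x, `|T x| <= c * `|x|) ->
      `|f T - g T| <= e * c) -> approximable f.
Proof.
move=> hf e e0; have e20 : 0 < e / 2 by rewrite divr_gt0.
have [g hg fg] := hf _ e20; have [s gs] := hg _ e20.
exists s => T c c0 Tc; rewrite -(subrKA (g T)) (le_trans (ler_normD _ _))//.
by rewrite [e]splitr mulrDl lerD//; [exact: fg|exact: gs].
Qed.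

Lemma approximable_vector (xi eta : H) : approximable (fun T => dot (T xi) eta).
Proof.
move=> e e0; have e20 : 0 < e / 2 by rewrite divr_gt0.
have n1 (z : H) : 0 < `|z| + 1 by rewrite ltr_wpDl.
have [_ [x _ <-] hx] := dense_ball xi L_dense (divr_gt0 e20 (n1 eta)).
have [_ [y _ <-] hy] := dense_ball eta L_dense (divr_gt0 e20 (n1 (L x))).
exists [:: (x, y)] => T c c0 Tc; rewrite big_seq1 /=.
have -> : dot (T xi) eta - dot (T (L x)) (L y) =
    dot (T (xi - L x)) eta + dot (T (L x)) (eta - L y).
  by rewrite (linear_sub (bop_linear T)) dotBl dotBr addrA subrK.
have est (d a : C) : 0 <= a -> d < e / 2 / (a + 1) -> d * a <= e / 2.
  move=> a0 da; have a1 : 0 < a + 1 by rewrite ltr_wpDl.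
  rewrite (le_trans (ler_wpM2r a0 (ltW da)))// mulrAC ler_pdivrMr//.
  by rewrite ler_pM2l// lerDl.
rewrite (le_trans (ler_normD _ _))// [e]splitr mulrDl lerD//.
  rewrite (le_trans (cauchy_schwarz _ _))// (le_trans (ler_wpM2r _ (Tc _)))//.
  by rewrite -mulrA mulrC ler_wpM2r// est.
rewrite (le_trans (cauchy_schwarz _ _))// (le_trans (ler_wpM2r _ (Tc _)))//.
by rewrite -mulrA mulrC ler_wpM2r// mulrC est.
Qed.

Hypothesis archC : forall x : C, 0 <= x -> exists n : nat, x < n%:R.

Lemma approximable_normal (w : {scalar (bop H H)}) : normal w -> approximable w.
Proof.
move=> /(normal_sum archC)[n [c [p [sp wE]]]].
have -> : (w : bop H H -> C) = fun T => \sum_(i < n) c i * sigma_weak (p i) T.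
  by apply/funext.
apply: (approximable_sum (f := fun i T => c i * sigma_weak (p i) T)) => i ni.
apply: approximableZ; apply: approximable_lim => e e0.
have [N hN] := sigma_weak_tail archC (sp i ni) e0.
exists (fun T => \sum_(k < N) dot (T ((p i).1 k)) ((p i).2 k)) => //.
apply: (approximable_sum (f := fun k T => dot (T ((p i).1 k)) ((p i).2 k))) => k _.
exact: approximable_vector.
Qed.

End Approximation.

Section VectorFunctionals.
Variables (C : numClosedFieldType) (H : hilbertType C).

Definition vector_functional (s : seq (H * H)) (T : bop H H) : C :=
  \sum_(p <- s) dot (T p.1) p.2.

Lemma vector_functional_scalar s : scalar (vector_functional s).
Proof.
move=> c S T; rewrite /vector_functional mulr_sumr -big_split /=.
by apply: eq_bigr => p _; exact: dot_scalar.
Qed.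

HB.instance Definition _ s := GRing.isLinear.Build C (bop H H) C *%R
  (vector_functional s) (vector_functional_scalar s).

Lemma vector_functional_normal s : normal (vector_functional s : {scalar (bop H H)}).
Proof.
(* A vector becomes a square-summable sequence supported at index 0, so each sigma-weak series has a
   single term. *)
pose single (x : H) (n : nat) : H := if n == 0%N then x else 0.
pose t := [seq (single p.1, single p.2) | p <- s].
have ss (x : H) : square_summable (single x).
  exists (`|x| ^+ 2) => n; rewrite -(big_mkord xpredT (fun k => `|single x k| ^+ 2)).
  case: n => [|n]; first by rewrite big_geq// exprn_ge0.
  rewrite big_nat_recl//= big1 ?addr0// => k _.
  by rewrite normr0 expr0n.
exists t.
  move=> i; rewrite size_map => si.
  by rewrite (nth_map (0, 0))//; split; exact: ss.
exists 1 => T; rewrite mul1r big_map.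
rewrite (le_trans (ler_norm_sum _ _ _))//; apply: ler_sum => p _.
suff -> : sigma_weak (single p.1, single p.2) T = dot (T p.1) p.2 by [].
(* The partial sums are constant from index 1 on; at index 0 the sum is empty. *)
apply: (@norm_lim_near_cst C C^o); exists 1%N => // -[//|n] _.
rewrite /series /= big_nat_recl//= big1 ?addr0// => k _.
by rewrite (linear_map0 (bop_linear T)) dot0l.
Qed.

End VectorFunctionals.

Lemma complex_archimedean (R : realType) (x : R[i]) : 0 <= x ->
  exists n : nat, x < n%:R.
Proof.
case: x => a b /=; rewrite lecE /= => /andP[/eqP -> a0].
exists (Num.bound a); have -> : (Num.bound a)%:R = ((Num.bound a)%:R)%:C%C :> R[i].
  by rewrite rmorph_nat.
by rewrite ltcE /= eqxx archi_boundP.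
Qed.

(** * The two inclusions between slices and the algebra *)

Section MainInclusions.
Variables (C : numClosedFieldType) (A : starAlgType C).
Variables (Delta : A -> mult (tensor A A)) (hDelta : mult_hopf_star Delta).
Variables (psi : {scalar A}) (hpsi : right_integral Delta psi).
Variables (H : gns_completion psi) (K : hilbert_tensor H H).
Local Notation V := (right_regular Delta K).

(** Matrix coefficients determine an operator, so any [T] with the right ones is the one that [xget]
    picks. *)
Lemma sliceE (w : {scalar (bop H H)}) (T : bop H H) :
  (forall xi eta, dot (T xi) eta = w (vector_slice V xi eta)) -> slice w V = T.
Proof.
move=> TE; have := @xgetPex _ 0 [set T : bop H H | forall xi eta : H,
  dot (T xi) eta = w (vector_slice V xi eta)] (ex_intro _ T TE).
rewrite -/(slice w V) => SE; apply: val_inj; apply/funext => xi /=.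
apply/eqP; rewrite -subr_eq0; apply/eqP/dot_eq0 => eta.
by rewrite dotBl SE TE subrr.
Qed.

Lemma range_gns_action_sub : range (gns_action H) `<=`
  [set slice w V | w in @normal C H].
Proof.
have [ndA homD [Tr [lTr _ TrE]] [Tl [lTl bTl TlE]] _] := hDelta.
move=> _ [a _ <-].
have [s ->] := regular_coef_span hpsi lTl bTl a.
exists (vector_functional [seq (Lambda H p.1, Lambda H p.2) | p <- s]).
  exact: vector_functional_normal.
apply: sliceE => xi eta.
rewrite (gns_action_sum ndA K homD hpsi lTr TrE lTl bTl TlE).
by rewrite /= /vector_functional big_map.
Qed.

Hypothesis archC : forall x : C, 0 <= x -> exists n : nat, x < n%:R.

Lemma slices_sub : [set slice w V | w in @normal C H] `<=`
  norm_closure (range (gns_action H)).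
Proof.
have [ndA homD [Tr [lTr _ TrE]] [Tl [lTl bTl TlE]] _] := hDelta.
move=> _ [w nw <-] e e0.
have [c c0 Vc] := vector_slice_bound V.
have aw := approximable_normal (@Lambda_linear _ _ _ H) (@Lambda_dense _ _ _ H)
  archC nw.
(* The precision e/c compensates the bound c |xi| |eta| on vector slices, leaving e |xi| |eta| on
   matrix coefficients and so [e] in operator norm. *)
have [s hs] := aw _ (divr_gt0 e0 c0).
pose S := [set T : bop H H | forall xi eta : H,
  dot (T xi) eta = w (vector_slice V xi eta)].
have [[T TE]|NS] := pselect (exists T, S T).
  rewrite (sliceE TE).
  exists (gns_action H (\sum_(p <- s) regular_coef psi Tl p.1 p.2)).
    by eexists.
  move=> xi; apply: norm_le_dot => [|eta]; first by rewrite mulr_ge0// ltW.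
  rewrite dotBl TE (gns_action_sum ndA K homD hpsi lTr TrE lTl bTl TlE).
  apply: (le_trans (hs _ (c * `|xi| * `|eta|) _ (Vc xi eta))).
    by rewrite !mulr_ge0// ltW.
  by rewrite -!mulrA mulKf// gt_eqF.
(* If no operator has the coefficients prescribed by [w], [slice] takes its default value 0, which
   is the action of the element 0. *)
exists (gns_action H 0); first by eexists.
have -> : slice w V = 0 by apply: xgetPN => T ST; apply: NS; exists T.
have lin := gns_action_linear ndA K homD hpsi lTr TrE lTl bTl TlE.
move=> xi; rewrite (linear_map0 (lin xi)).
by rewrite subrr normr0 mulr_ge0// ltW.
Qed.

End MainInclusions.

Theorem theorem3p11 (R : realType) (A : starAlgType R[i])
    (Delta : A -> mult (tensor A A)) (hDelta : mult_hopf_star Delta)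
    (phi : {scalar A})
    (hphi : left_integral Delta phi) (hphi0 : positive_functional phi)
    (psi : {scalar A})
    (hpsi : right_integral Delta psi) (hpsi0 : positive_functional psi)
    (H : gns_completion psi) (K : hilbert_tensor H H) :
  let M := vn_quantum_group Delta K in
  let V := right_regular Delta K in
  let P := norm_closure (range (gns_action H)) in
  P `<=` ob_carrier M /\ cstar_quantum_group M V = ob_restrict M P.
Proof.
move=> M V P; split; first exact: norm_closure_sub_weak.
(* Both coproducts restrict the same graph, so equality of the carriers suffices. *)
rewrite /cstar_quantum_group; congr (ob_restrict M _).
apply/seteqP; split; apply: norm_closure_min.
- exact/slices_sub/complex_archimedean.
- by move=> T /(range_gns_action_sub hDelta hpsi K); exact: sub_norm_closure.
Qed.
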